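(* Let $n\ge 1$ and let $X_n=\{x_0,x_1,\dots,x_n\}\subset F$, where $F$ is Thompson's group. For every $g\in F$, the word length $l_n(g)$ of $g$ with respect to the generating set $X_n$ is given by the formula $$l_n(g)=l_\infty(g)+2p_n(g),$$ where $l_\infty(g)$ is the number of carets in the reduced tree pair diagram for $g$ which are not right carets (counted over both trees of the pair), and $p_n(g)$ is the penalty weight (penalty contribution) of $g$.
   Context: **Group.** Thompson's group is $F=\langle x_k,\ k\ge 0\mid x_i^{-1}x_jx_i=x_{j+1}\text{ if } i<j\rangle$. For $n\ge1$ the set $X_n=\{x_0,\dots,x_n\}$ generates $F$. **Trees and carets.** Trees are finite rooted binary trees with at least one caret. A caret is a vertex together with two downward edges, its left and right edges. The left (right) child of a caret $c$ is the caret attached to the lower end of its left (right) edge, if there is one; otherwise that end is a leaf. The left (right) side of a tree is the maximal path of left (right) edges beginning at the root caret. A caret is a left (right) caret if one of its edges lies on the left (right) side; the root caret counts as both a left and a right caret (in particular the root is a right caret and is not counted in $l_\infty$). A caret that is neither left nor right is interior. Carets of a tree with $N$ carets are numbered $1,\dots,N$ in infix order (all carets in the left subtree of $c$, then $c$, then all carets in the right subtree of $c$) and are named by these numbers; leaves are numbered $0,\dots,N$ from left to right. **Tree pair diagrams.** A tree pair diagram is a pair $(T_-,T_+)$ of trees with the same number of carets. It is unreduced if for some $i$ both trees contain a caret both of whose ends are leaves, numbered $i,i+1$; removing such pairs of carets repeatedly gives a reduced diagram. The leaf exponent $E(k)$ of leaf $k$ in a tree is the length of the longest upward path of left edges starting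 at leaf $k$ that does not reach the right side of the tree (so edges with an endpoint on the right side, including the root vertex, are not used). A reduced diagram $(T_-,T_+)$ represents the element $x_0^{E_+(0)}x_1^{E_+(1)}\cdots x_N^{E_+(N)}\,x_N^{-E_-(N)}\cdots x_1^{-E_-(1)}x_0^{-E_-(0)}$, where $E_\pm$ are the leaf exponents in $T_\pm$; every element of $F$ is represented by a unique reduced tree pair diagram. Writing $g=(T_-,T_+)$ means that this is the reduced diagram of $g$. The identity is represented by the pair of one-caret trees. ''Caret $p$'' of $(T_-,T_+)$ means the pair of carets numbered $p$ in $T_-$ and $T_+$. **Penalty carets.** Caret $p$ in a tree $T$ has type $N$ if caret $p+1$ exists, is an interior caret, and lies in the right subtree of $p$. Caret $p$ of $(T_-,T_+)$ is a penalty caret if either (1) $p$ has type $N$ in $T_-$ or in $T_+$, or (2) $p$ is a right caret in both $T_-$ and $T_+$ and $p$ is not the final (highest-numbered) caret. **Adjacency.** In a tree, the generalized left edge of a caret $c$ consists of the left edge of $c$ together with the right edges of all carets on the path that starts at the left child of $c$ and repeatedly passes to right children. The generalized right edge of $c$ consists of the right edge of $c$ together with the left edges of all carets on the path that starts at the right child of $c$ and repeatedly passes to left children. For carets $p<q$ of $(T_-,T_+)$, write $p\prec q$ if in $T_-$ or in $T_+$ some caret edge is part of both the generalized right edge of $p$ and the generalized left edge of $q$. (Always $p\prec p+1$; the relation is not transitive.) There is also a dummy caret $v_0$ (number $0$), with $v_0\prec q$ exactly when $q$ is a left caret in $T_-$ or in $T_+$. **Penalty trees.** A penalty tree $\mathcal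 P$ for $g=(T_-,T_+)$ is a rooted tree with root $v_0$, with edges directed away from the root, such that: (i) its vertices are $v_0$ and a subset of the carets of $(T_-,T_+)$; (ii) if there is a directed edge from $p$ to $q$ then $p\prec q$; (iii) every penalty caret is a vertex; (iv) every leaf (vertex with no outgoing edge) is a penalty caret, the only exception being when $\mathcal P$ consists only of $v_0$. If there is a directed path in $\mathcal P$ between two vertices $p,q$, $d_{\mathcal P}(p,q)$ denotes its number of edges. **Penalty weight.** A vertex $v$ of $\mathcal P$ is weighted (with respect to $n$) if $d_{\mathcal P}(v_0,v)\ge 2$ and there is a leaf $l$ of $\mathcal P$, equal to $v$ or a descendant of $v$, with $d_{\mathcal P}(v,l)\ge n-1$. $p_n(\mathcal P)$ is the number of weighted vertices of $\mathcal P$, and $p_n(g)=\min\{p_n(\mathcal P)\mid \mathcal P \text{ is a penalty tree for } g\}$. *)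

(* Defs.v *)
From HB Require Import structures.
From mathcomp Require Import all_boot.
From mathcomp Require Import boolp classical_sets.

Set Implicit Arguments.
Unset Strict Implicit.
Unset Printing Implicit Defensive.

(* The least element of A, and 0 by convention if A is empty. *)
Definition natmin (A : set nat) : nat :=
  xget 0 [set k | A k /\ forall m, A m -> k <= m]%classic.

(* The letter (i, false) stands for x_i and (i, true) for its inverse. *)
Notation letter := (nat * bool)%type.
Notation word := (seq letter).
Definition linv (a : letter) : letter := (a.1, ~~ a.2).
Definition winv (w : word) : word := rev (map linv w).

Inductive Feq : word -> word -> Prop :=
| Feq_refl u : Feq u u
| Feq_sym u v : Feq u v -> Feq v u
| Feq_trans u v w : Feq u v -> Feq v w -> Feq u w
| Feq_cat u u' v v' : Feq u u' -> Feq v v' -> Feq (u ++ v) (u' ++ v')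
| Feq_cancel a : Feq [:: a; linv a] [::]
| Feq_rel i j : i < j ->
    Feq [:: (i, true); (j, false); (i, false)] [:: (j.+1, false)].

Definition Feqb : rel word := fun u v => `[< Feq u v >].

Lemma Feqb_refl : reflexive Feqb.
Proof. by move=> u; apply/asboolP; exact: Feq_refl. Qed.

Lemma Feqb_sym : symmetric Feqb.
Proof.
by move=> u v; apply/idP/idP => /asboolP uv; apply/asboolP; exact: Feq_sym.
Qed.

Lemma Feqb_trans : transitive Feqb.
Proof.
move=> v u w /asboolP uv /asboolP vw; apply/asboolP.
exact: Feq_trans uv vw.
Qed.

Canonical Feq_equiv := EquivRel Feqb Feqb_refl Feqb_sym Feqb_trans.

Definition F : Type := {eq_quot Feqb}%qT.
HB.instance Definition _ := Choice.on F.

Definition Fclass (w : word) : F := (\pi_{eq_quot Feqb} w)%qT.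
Definition Frepr (g : F) : word := repr (g : {eq_quot Feqb}%qT).

Lemma FclassP u v : Fclass u = Fclass v <-> Feq u v.
Proof.
split=> [/eqmodP/asboolP //|uv].
by apply/eqmodP/asboolP.
Qed.

Lemma FclassK (g : F) : Fclass (Frepr g) = g.
Proof. exact: reprK. Qed.

Lemma Frepr_class u : Feq (Frepr (Fclass u)) u.
Proof. by apply/FclassP; exact: FclassK. Qed.

Definition F1 : F := Fclass [::].
Definition Fmul (g h : F) : F := Fclass (Frepr g ++ Frepr h).
Definition Finv (g : F) : F := Fclass (winv (Frepr g)).

Lemma linvK : involutive linv.
Proof. by case=> i b; rewrite /linv /= negbK. Qed.

Lemma winvK : involutive winv.
Proof.
by move=> w; rewrite /winv map_rev revK -map_comp map_id_in // => a _; exact: linvK.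
Qed.

Lemma Feq_winvr u : Feq (u ++ winv u) [::].
Proof.
elim: u => [|a u IHu]; first exact: Feq_refl.
rewrite /winv /= rev_cons -cats1 -/(winv u) -cat1s catA -(cat1s a) -catA.
apply: Feq_trans (Feq_cancel a).
rewrite -[[:: a; _]]/([:: a] ++ [:: linv a]).
apply: Feq_cat; first exact: Feq_refl.
rewrite catA -[X in Feq _ X]/([::] ++ [:: linv a]).
by apply: Feq_cat => //; exact: Feq_refl.
Qed.

Lemma Feq_winvl u : Feq (winv u ++ u) [::].
Proof. by rewrite -{2}(winvK u); exact: Feq_winvr. Qed.

Lemma FmulE u v : Fmul (Fclass u) (Fclass v) = Fclass (u ++ v).
Proof. by apply/FclassP; apply: Feq_cat; exact: Frepr_class. Qed.

Lemma FmulA : associative Fmul.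
Proof.
by move=> f g h; rewrite -(FclassK f) -(FclassK g) -(FclassK h) !FmulE catA.
Qed.

Lemma F1mul : left_id F1 Fmul.
Proof. by move=> g; rewrite -(FclassK g) FmulE. Qed.

Lemma Fmul1 : right_id F1 Fmul.
Proof. by move=> g; rewrite -(FclassK g) FmulE cats0. Qed.

Lemma FmulVg : left_inverse F1 Finv Fmul.
Proof.
by move=> g; rewrite -{2}(FclassK g) FmulE; apply/FclassP; exact: Feq_winvl.
Qed.

Lemma FmulgV : right_inverse F1 Finv Fmul.
Proof.
by move=> g; rewrite -{1}(FclassK g) FmulE; apply/FclassP; exact: Feq_winvr.
Qed.

HB.instance Definition _ := isGroup.Build F FmulA F1mul Fmul1 FmulVg FmulgV.

Definition x_ (i : nat) : F := Fclass [:: (i, false)].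

Definition X_ (n : nat) : set F := [set x_ i | i in [set i | i <= n]]%classic.

(* Meaningful if S generates G; see the convention in natmin. *)
Definition word_length (G : groupType) (S : set G) (g : G) : nat :=
  natmin [set k | exists s : seq G,
    [/\ size s = k, forall y, y \in s -> S y \/ S (y^-1)%g
      & \big[*%g/1%g]_(y <- s) y = g]]%classic.

(* A caret is a node; [Leaf] alone is the tree without carets. *)
Inductive tree := Leaf | Node of tree & tree.

Fixpoint tree_encode t : GenTree.tree unit :=
  if t is Node l r then GenTree.Node 0 [:: tree_encode l; tree_encode r]
  else GenTree.Leaf tt.

Fixpoint tree_decode (t : GenTree.tree unit) : tree :=
  if t is GenTree.Node _ [:: l; r] then Node (tree_decode l) (tree_decode r)
  else Leaf.

Lemma tree_encodeK : cancel tree_encode tree_decode.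
Proof. by elim=> //= l -> r ->. Qed.

HB.instance Definition _ := Countable.copy tree (can_type tree_encodeK).

(* Vertices (carets and leaves) are named by their address: the path from the
   root, false for a left edge and true for a right edge. An edge is named by
   the address of its lower end, so the left and right edges of the caret a
   are [rcons a false] and [rcons a true]. *)
Notation address := (seq bool).

Fixpoint carets (t : tree) : seq address :=
  if t is Node l r
  then map (cons false) (carets l) ++ [::] :: map (cons true) (carets r)
  else [::].

Fixpoint leaves (t : tree) : seq address :=
  if t is Node l r
  then map (cons false) (leaves l) ++ map (cons true) (leaves r)
  else [:: [::]].

Definition ncarets (t : tree) : nat := size (carets t).

(* Carets are numbered from 1, leaves from 0. *)
Definition caret (t : tree) (p : nat) : address := nth [::] (carets t) p.-1.
Definition leaf (t : tree) (k : nat) : address := nth [::] (leaves t) k.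

Definition left_edge (a : address) : address := rcons a false.
Definition right_edge (a : address) : address := rcons a true.

(* These apply to vertices and, through their lower ends, to edges. *)
Definition on_left_side (a : address) : bool := all negb a.
Definition on_right_side (a : address) : bool := all id a.

Definition left_caret (a : address) : bool :=
  on_left_side (left_edge a) || on_left_side (right_edge a).
Definition right_caret (a : address) : bool :=
  on_right_side (left_edge a) || on_right_side (right_edge a).
Definition interior_caret (a : address) : bool :=
  ~~ left_caret a && ~~ right_caret a.

(* Left edges with neither endpoint on the right side of the tree *)
Definition exponent_edge (e : address) : bool :=
  [&& e != [::], ~~ last true e, ~~ on_right_side e
    & ~~ on_right_side (take (size e).-1 e)].

(* The i-th edge of the upward path from leaf a is [take (size a - i) a]. *)
Definition leaf_exponent (t : tree) (k : nat) : nat :=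
  let a := leaf t k in
  \max_(m < (size a).+1 |
        all (fun i => exponent_edge (take (size a - i) a)) (iota 0 m)) m.

Notation tree_pair := (tree * tree)%type.

Definition size_pair (D : tree_pair) : nat := ncarets D.1.

Definition is_tree_pair (D : tree_pair) : bool :=
  (0 < ncarets D.1) && (ncarets D.1 == ncarets D.2).

Definition exposed (t : tree) (i : nat) : bool :=
  has (fun a => (left_edge a == leaf t i) && (right_edge a == leaf t i.+1))
      (carets t).

(* The pair of one-caret trees counts as reduced, since removing its carets
   would leave no tree with at least one caret. *)
Definition is_reduced (D : tree_pair) : bool :=
  (size_pair D == 1) ||
  ~~ has (fun i => exposed D.1 i && exposed D.2 i) (iota 0 (size_pair D)).

Definition represented (D : tree_pair) : F :=
  let N := size_pair D in
  (\big[*%g/1]_(k <- iota 0 N.+1) x_ k ^+ leaf_exponent D.2 k *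
   \big[*%g/1]_(k <- rev (iota 0 N.+1)) x_ k ^- leaf_exponent D.1 k)%g.

(* The reduced diagram of g; it exists and is unique for every g in F. *)
Definition reduced_diagram (g : F) : tree_pair :=
  xget (Node Leaf Leaf, Node Leaf Leaf)
    [set D | [/\ is_tree_pair D, is_reduced D & represented D = g]]%classic.

Definition typeN (t : tree) (p : nat) : bool :=
  [&& p.+1 <= ncarets t, interior_caret (caret t p.+1)
    & prefix (right_edge (caret t p)) (caret t p.+1)].

Definition penalty_caret (D : tree_pair) (p : nat) : bool :=
  (0 < p <= size_pair D) &&
  [|| typeN D.1 p, typeN D.2 p
    | [&& right_caret (caret D.1 p), right_caret (caret D.2 p)
        & p != size_pair D]].

(* b is on the path from the left child of a passing to right children *)
Definition on_left_spine (a b : address) : bool :=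
  prefix (left_edge a) b && all id (drop (size a).+1 b).
(* b is on the path from the right child of a passing to left children *)
Definition on_right_spine (a b : address) : bool :=
  prefix (right_edge a) b && all negb (drop (size a).+1 b).

Definition gen_left_edge (t : tree) (a : address) : seq address :=
  left_edge a :: [seq right_edge b | b <- carets t & on_left_spine a b].
Definition gen_right_edge (t : tree) (a : address) : seq address :=
  right_edge a :: [seq left_edge b | b <- carets t & on_right_spine a b].

Definition adjacent (t : tree) (p q : nat) : bool :=
  has (mem (gen_left_edge t (caret t q))) (gen_right_edge t (caret t p)).

(* Number 0 is the dummy caret v_0. *)
Definition prec (D : tree_pair) (p q : nat) : bool :=
  (p < q <= size_pair D) &&
  (if p == 0 then left_caret (caret D.1 q) || left_caret (caret D.2 q)
   else adjacent D.1 p q || adjacent D.2 p q).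

Record digraph (V : finType) := Digraph {
  vertices : {set V};
  edge : rel V
}.

Section Digraph.
Variables (V : finType) (P : digraph V).

(* A rooted tree, with edges directed away from the root r *)
Definition rooted_tree (r : V) : Prop :=
  [/\ r \in vertices P,
      forall u v, edge P u v -> u \in vertices P /\ v \in vertices P,
      forall u, ~~ edge P u r,
      forall v, v \in vertices P -> v != r -> exists! u, edge P u v
    & forall v, v \in vertices P -> connect (edge P) r v].

Definition leaf_vertex (v : V) : Prop :=
  v \in vertices P /\ forall w, ~~ edge P v w.

(* There is a directed path with d edges from u to v; in a rooted tree, this
   determines d. *)
Definition dist_is (u v : V) (d : nat) : Prop :=
  exists s : seq V, [/\ path (edge P) u s, last u s = v & size s = d].

Definition weighted (n : nat) (r v : V) : Prop :=
  [/\ v \in vertices P,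
      exists2 d, dist_is r v d & 2 <= d
    & exists l d, [/\ leaf_vertex l, dist_is v l d & n - 1 <= d]].

Definition weight (n : nat) (r : V) : nat := #|[set v | `[< weighted n r v >]]|.

End Digraph.

Definition penalty_tree (D : tree_pair) (P : digraph 'I_(size_pair D).+1) : Prop :=
  [/\ rooted_tree P ord0,
      forall p q, edge P p q -> prec D p q,
      forall p : 'I_(size_pair D).+1, penalty_caret D p -> p \in vertices P
    & vertices P = [set ord0] \/ forall l, leaf_vertex P l -> penalty_caret D l].

Definition penalty_weight_pair (n : nat) (D : tree_pair) : nat :=
  natmin [set k | exists2 P : digraph 'I_(size_pair D).+1,
            penalty_tree P & weight P n ord0 = k]%classic.

Definition non_right_carets (t : tree) : nat :=
  count (fun a => ~~ right_caret a) (carets t).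

Definition l_infty (g : F) : nat :=
  non_right_carets (reduced_diagram g).1 + non_right_carets (reduced_diagram g).2.

Definition penalty_weight (n : nat) (g : F) : nat :=
  penalty_weight_pair n (reduced_diagram g).

(* Main.v *)
Require Import Defs.
From mathcomp Require Import all_boot.
From mathcomp Require Import boolp classical_sets.
From mathcomp Require Import zify.

(** A tree pair enters the length formula only through the sequences a and b of
    leaf exponents of T_- and T_+, extended by 0.  Let h p = p - psum a p.
    This height grows by at most 1 per step, and it encodes the tree: a vertex
    off the right side whose leaves are p, ..., q-1 is the same as a pair
    p < q with h q <= h p + 1 and h r < h q for p < r < q ([span]), and the
    right carets are the records of h ([root_at]).  Generalized edges turn
    adjacency of carets into these vertices, so p precedes q in the sense of
    the penalty relation iff (p, q) is a span of a or of b ([linked]), and s has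
    type N in one of the trees iff a s + b s > 0.  A caret that is a right caret
    in both trees is not crossed by any span, so every chain from v_0 to a type N
    caret beyond it visits it; hence it suffices to reach the type N carets.

    A penalty tree amounts to a list W of carets that are paid for.  The
    condition on W is that every type N caret is the end of a chain from v_0
    made of one free step, then steps to members of W, then at most n-1 free
    steps ([level], [sufficient]); the least size of such a W is p_n
    ([penalty_weightP]).

    Right multiplication by the inverse of x_k puts a caret on the k-th and
    (k+1)-st trees of the forest a, which creates exactly one new span, from
    the k-th root to the (k+2)-nd.  If the new caret faces an exposed caret
    of b, then both disappear together with one leaf.  Hence a generator x_k
    with k <= n changes (number of carets that are not right) + 2 |W| by at
    most 1 ([represents_step]): the caret that is added starts at the k-th
    root, which is k <= n free steps away, and when a caret is removed every
    chain through the lost span is repaired by one extra payment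
    ([sufficient_unincr]).  This is the lower bound.

    For the upper bound some generator must lower the sum
    ([improving_move]).  Follow the roots of a and look for the first place
    where walking along the roots is no longer the cheapest way to the next
    root.  The span that leads there is used by no cheapest chain, so the
    caret carrying it can be removed for free.  If that tree of the forest is a
    single leaf, then either one of the single leaves just before it allows a
    cancellation with an exposed caret of b, or the last nontrivial tree before
    them carries a span that no cheapest chain needs.  In the one remaining
    case the root number 2 (counting from 0) is paid for, and joining the first
    two trees saves the payment.

    Finally a reduced pair of sequences is determined by the element of F
    ([represents_inj]), because F acts on nat * nat in such a way that the
    exponent of x_i in a word on x_i, x_(i+1), ... can be read off
    ([exponent_balance]); so the bounds apply to the reduced diagram. *)

Set Implicit Arguments.
Unset Strict Implicit.
Unset Printing Implicit Defensive.

(** * Forests as exponent sequences *)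

Section Spans.

Implicit Types (a b : nat -> nat) (W : seq nat).

Definition psum a p := \sum_(i < p) a i.

(** In terms of the height r - [psum a r] (kept in [nat] by moving the
    subtraction across): the end q is at most one higher than p and strictly
    higher than everything in between.  These are the vertices of the forest
    with leaf exponents [a] that cover the leaves p, ..., q-1. *)
Definition span a p q :=
  [/\ p < q, q + psum a p <= p.+1 + psum a q
    & forall r, p < r < q -> r + psum a q < q + psum a r].

(** q is where the height first reaches k, that is, the leftmost leaf of the
    k-th tree of the forest. *)
Definition root_at a k q :=
  q = k + psum a q /\ forall r, r < q -> r < k + psum a r.

Definition vanish_from a B := forall i, B <= i -> a i = 0.

Lemma psum0 a : psum a 0 = 0.
Proof. by rewrite /psum big_ord0. Qed.

Lemma psumS a p : psum a p.+1 = psum a p + a p.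
Proof. by rewrite /psum big_ord_recr. Qed.

Lemma psum_le a p q : p <= q -> psum a p <= psum a q.
Proof.
move/subnKC <-; elim: (q - p) => [|m IH]; first by rewrite addn0.
by rewrite addnS psumS; lia.
Qed.

Lemma eq_psum a b p : (forall i, i < p -> a i = b i) -> psum a p = psum b p.
Proof. by move=> eqab; apply: eq_bigr => i _; apply: eqab. Qed.

Lemma psum_vanish a B p : vanish_from a B -> B <= p -> psum a p = psum a B.
Proof.
move=> aB /subnKC <-; elim: (p - B) => [|m IH]; first by rewrite addn0.
by rewrite addnS psumS aB; lia.
Qed.

Lemma span_succ a p : span a p p.+1.
Proof. by split=> // [|r]; rewrite ?psumS; lia. Qed.

(** A leaf of exponent 0 is not the left end of any caret, so only the leaf
    itself starts there. *)
Lemma span_trivial a p q : a p = 0 -> span a p q -> q = p.+1.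
Proof.
move=> ap0 [ltpq hpq vis]; have [//|neq] := eqVneq q p.+1.
have:= vis p.+1; rewrite psumS; lia.
Qed.

Lemma span_last a p q : span a p q.+1 -> p < q -> a q = 0.
Proof. by move=> [_ _ vis] pq; have := vis q; rewrite psumS; lia. Qed.

(** The last nonzero exponent before y belongs to a caret both of whose ends
    are leaves. *)
Lemma exposed_in a s y : 0 < a s -> s < y -> a y = 0 ->
  exists j, [/\ s <= j, j < y, 0 < a j & a j.+1 = 0].
Proof.
move=> as0; elim: y => // y IH; rewrite ltnS leq_eqVlt => /orP [/eqP <-|sy] ay.
  by exists s.
have [ay0|apos] := posnP (a y); last by exists y; split=> //; lia.
by have [j [? ? ? ?]] := IH sy ay0; exists j; split=> //; lia.
Qed.

Lemma root_at_fun a k q q' : root_at a k q -> root_at a k q' -> q = q'.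
Proof.
move=> [e v] [e' v']; case: (ltngtP q q') => // lt.
  by have := v' _ lt; lia.
by have := v _ lt; lia.
Qed.

Lemma root_at_exists a B k : vanish_from a B -> exists q, root_at a k q.
Proof.
move=> aB.
have ex : exists q, k + psum a q <= q.
  exists (k + psum a B + B); rewrite (psum_vanish aB) //; lia.
case: (ex_minnP ex) => q hq qmin; exists q.
have lt r : r < q -> r < k + psum a r.
  by move=> rq; rewrite ltnNge; apply/negP => /qmin; lia.
split=> //; case: q hq qmin lt => [|q] hq qmin lt; first by rewrite psum0 in hq *; lia.
by have := lt q (ltnSn q); have := @psum_le a q q.+1 (leqnSn q); lia.
Qed.

Lemma visible_root a p :
  (forall x, x < p -> x + psum a p < p + psum a x) -> root_at a (p - psum a p) p.
Proof.
move=> v; have le : psum a p <= p.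
  by case: p v => [|p] v; [rewrite psum0 | have := v 0; rewrite psum0; lia].
by split=> [|x xp]; [lia | have := v x xp; lia].
Qed.

Lemma root_at0 a : root_at a 0 0.
Proof. by split=> //; rewrite psum0. Qed.

Lemma root_at_mono a k l q q1 : root_at a k q -> root_at a l q1 -> k < l -> q < q1.
Proof.
move=> [e v] [e1 v1] kl; case: (ltngtP q q1) => // [lt|eq]; last by subst q1; lia.
by have := v _ lt; lia.
Qed.

Lemma span_root a k q q1 : root_at a k q -> root_at a k.+1 q1 -> span a q q1.
Proof.
move=> rq rq1; have lt := root_at_mono rq rq1 (ltnSn _).
case: rq rq1 => [e v] [e1 v1]; split=> //; first lia.
by move=> r /andP [qr rq1]; have := v1 _ rq1; lia.
Qed.

(** A vertex lies inside one tree of the forest: its end may not exceed the height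
    of its beginning by more than 1, which stays below the record at the next
    root. *)
Lemma span_over_root a k q x y : root_at a k q -> span a x y -> x < q -> y <= q.
Proof.
move=> [e v] [xy h vis] xq; rewrite leqNgt; apply/negP => qy.
by have := vis q; have := v _ xq; lia.
Qed.

Lemma root_at_succ a k q : root_at a k q -> a q = 0 -> root_at a k.+1 q.+1.
Proof.
move=> [e v] aq; split=> [|r]; rewrite ?psumS; first lia.
by rewrite ltnS leq_eqVlt => /orP [/eqP ->|/v]; lia.
Qed.

Lemma root_at_add a k q m : root_at a k q -> (forall i, q <= i < q + m -> a i = 0) ->
  root_at a (k + m) (q + m).
Proof.
move=> rq; elim: m => [|m IH] a0; first by rewrite !addn0.
rewrite !addnS; apply: root_at_succ; last by apply: a0; lia.
by apply: IH => i ?; apply: a0; lia.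
Qed.

Lemma root_at_pred0 a k q : root_at a k q.+1 -> a q = 0.
Proof. by move=> [e v]; have := v q (ltnSn q); rewrite psumS in e; lia. Qed.

Lemma root_at_below a k q : root_at a k.+1 q -> exists2 q', root_at a k q' & q' < q.
Proof.
move=> rq; have [q' rq'] : exists q', root_at a k q'.
  have [e v] := rq.
  have ex : exists q, k + psum a q <= q by exists q; lia.
  case: (ex_minnP ex) => q' hq qmin; exists q'.
  have lt r : r < q' -> r < k + psum a r.
    by move=> rq1; rewrite ltnNge; apply/negP => /qmin; lia.
  split=> //; case: q' hq qmin lt => [|q'] hq qmin lt; first by rewrite psum0 in hq *; lia.
  by have := lt q' (ltnSn q'); have := @psum_le a q' q'.+1 (leqnSn q'); lia.
by exists q' => //; apply: root_at_mono rq' rq (ltnSn _).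
Qed.

Lemma root_at_eq a b k q : (forall i, i < q -> a i = b i) -> root_at a k q -> root_at b k q.
Proof.
move=> eqab [e v]; split=> [|r rq]; first by rewrite -(eq_psum eqab).
by rewrite -(@eq_psum a) ?v // => i ir; apply: eqab; lia.
Qed.

Definition incr a q := fun i => a i + (i == q).

Lemma psum_incr a q p : psum (incr a q) p = psum a p + (q < p).
Proof. by elim: p => [|p IH]; rewrite ?psum0 // !psumS IH /incr; lia. Qed.

(** The new caret joins the trees that start at q and q1; its only effect on the
    set of vertices is the vertex from q to q2.  All heights after q drop
    by 1, which is exactly what makes q2 visible from q. *)
Lemma span_incr a k q q1 q2 x y :
  root_at a k q -> root_at a k.+1 q1 -> root_at a k.+2 q2 ->
  span (incr a q) x y <-> span a x y \/ (x = q /\ y = q2).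
Proof.
move=> rq rq1 rq2.
have qq1 := root_at_mono rq rq1 (ltnSn _); have q1q2 := root_at_mono rq1 rq2 (ltnSn _).
have [e v] := rq; have [e1 v1] := rq1; have [e2 v2] := rq2.
split=> [[xy h vis]|[sp|[-> ->]]].
- have [xq|qx] := ltnP x q; last first.
    have [eqx|neq] := eqVneq x q; last first.
      left; split=> //; first by move: h; rewrite !psum_incr; lia.
      by move=> r xr; have := vis r xr; rewrite !psum_incr; lia.
    subst x; have [le|gt] := leqP y q1.
      left; split=> //; first by move: h; rewrite !psum_incr;
        case: (ltngtP y q1) le => // [/v1|->]; lia.
      by move=> r xr; have := vis r xr; rewrite !psum_incr; lia.
    right; split=> //.
    have hy := h; rewrite !psum_incr in hy.
    case: (ltngtP y q2) => // yq2; first by have := v2 _ yq2; have := vis q1;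
      rewrite !psum_incr; lia.
    by have := vis q2; rewrite !psum_incr; lia.
  left; have [yq|qy] := leqP y q.
    split=> //; first by move: h; rewrite !psum_incr; lia.
    by move=> r xr; have := vis r xr; rewrite !psum_incr; lia.
  by have := vis q; have := v _ xq; move: h; rewrite !psum_incr; lia.
- have [xy h vis] := sp; split=> //.
    by rewrite !psum_incr; lia.
  move=> r xr; have := vis r xr; rewrite !psum_incr.
  have [xq|qx] := ltnP x q; last by lia.
  by have := span_over_root rq sp xq; lia.
- split; first lia.
    by rewrite !psum_incr; lia.
  move=> r /andP [qr rq2']; have := v2 _ rq2'; rewrite !psum_incr; lia.
Qed.

(** A new leaf j+1, of exponent 0, to the right of leaf j. *)
Definition insert0 j a := fun i => if i <= j then a i else if i == j.+1 then 0 else a i.-1.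

Lemma psum_insert0 j a p : psum (insert0 j a) p = psum a (if p <= j.+1 then p else p.-1).
Proof.
elim: p => [|p IH]; first by rewrite !psum0.
rewrite psumS IH /insert0.
have [pj|jp] := leqP p j; first by rewrite leqW // ltnS pj psumS.
have [->|neq] := eqVneq p j.+1; first by rewrite leqnn ltnn addn0.
have -> : (p <= j.+1) = false by lia.
have -> : (p.+1 <= j.+1) = false by lia.
by rewrite /= -psumS prednK //; lia.
Qed.

Lemma insert0_lt j a i : i <= j -> insert0 j a i = a i.
Proof. by rewrite /insert0 => ->. Qed.

Lemma insert0_eq j a : insert0 j a j.+1 = 0.
Proof. by rewrite /insert0 ltnn eqxx. Qed.

Lemma insert0_gt j a i : j.+1 <= i -> insert0 j a i.+1 = a i.
Proof.
rewrite /insert0 => ji; have -> : (i.+1 <= j) = false by lia.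
by have -> : (i.+1 == j.+1) = false by lia.
Qed.

Lemma insert0K j a : a j.+1 = 0 -> insert0 j (fun i => a (bump j.+1 i)) = a.
Proof.
move=> aj; apply: funext => i; rewrite /insert0 /bump.
have [ij|ji] := leqP i j; first by congr a; lia.
have [->//|neq] := eqVneq i j.+1.
by congr a; lia.
Qed.

(** [bump j.+1] renumbers the old leaves, skipping the new one. *)
Lemma psum_bump j a p : psum (insert0 j a) (bump j.+1 p) = psum a p.
Proof. by rewrite psum_insert0 /bump; congr psum; case: ifP; lia. Qed.

Lemma bumpE j p : (bump j.+1 p = p /\ p <= j) \/ (bump j.+1 p = p.+1 /\ j < p).
Proof. by rewrite /bump; have [jp|pj] := ltnP j p; [right|left]; split=> //; lia. Qed.

Lemma unbumpE j p : (unbump j p = p /\ p <= j) \/ (p = (unbump j p).+1 /\ j < p).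
Proof. by rewrite /unbump; have [jp|pj] := ltnP j p; [right|left]; split=> //; lia. Qed.

(** Here the new leaf j+1 and leaf j are the ends of a new caret standing in the
    place of the old leaf j, so the old vertices are unaffected. *)
Lemma span_caret_bump j a x y :
  span (incr (insert0 j a) j) (bump j.+1 x) (bump j.+1 y) <-> span a x y.
Proof.
have P z : psum (incr (insert0 j a) j) (bump j.+1 z) = psum a z + (j < z).
  by rewrite psum_incr psum_bump; case: (bumpE j z) => -[-> ?]; lia.
have Pj : psum (incr (insert0 j a) j) j.+1 = psum a j.+1 + 1.
  by rewrite psum_incr psum_insert0 !leqnn.
split=> -[xy h vis].
- rewrite !P in h; split; first by move: xy; case: (bumpE j x) (bumpE j y) => -[-> ?] []
    [-> ?]; lia.
    by move: h; case: (bumpE j x) (bumpE j y) => -[-> ?] [] [-> ?]; lia.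
  move=> r xry; have := vis (bump j.+1 r); rewrite !P.
  by case: (bumpE j x) (bumpE j y) (bumpE j r) => -[-> ?] [] [-> ?] [] [-> ?]; lia.
- split; first by case: (bumpE j x) (bumpE j y) => -[-> ?] [] [-> ?]; lia.
    by rewrite !P; move: h; case: (bumpE j x) (bumpE j y) => -[-> ?] [] [-> ?]; lia.
  move=> r; have [->|rj] := eqVneq r j.+1.
    rewrite Pj P; have := vis j.+1.
    case: (eqVneq y j.+1) => [->|?]; first by case: (bumpE j x) (bumpE j j.+1) => -[-> ?]
      [] [-> ?]; lia.
    by case: (bumpE j x) (bumpE j y) => -[-> ?] [] [-> ?]; lia.
  have er : bump j.+1 (unbump j.+1 r) = r by rewrite unbumpK // inE; apply/eqP.
  have := vis (unbump j.+1 r); rewrite -er !P er.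
  have := bumpE j (unbump j.+1 r); rewrite er.
  by case: (bumpE j x) (bumpE j y) => -[-> ?] [] [-> ?] [] [? ?]; lia.
Qed.

(** Leaf j has positive exponent, so no vertex that begins before j ends between
    the two leaves of the new caret. *)
Lemma span_caret_in j a x : span (incr (insert0 j a) j) x j.+1 -> x = j.
Proof.
move=> sp; have [xj] := sp; case: (ltngtP x j) xj => // [xj _ _ _|]; last lia.
by have := span_last sp xj; rewrite /incr eqxx; lia.
Qed.

Lemma span_caret_out j a y : span (incr (insert0 j a) j) j.+1 y -> y = j.+2.
Proof. by apply: span_trivial; rewrite /incr insert0_eq; lia. Qed.

(** Here leaf j is a whole tree of the forest, and it is duplicated: j and j+1
    become two trivial trees.  The leaf j is the only old vertex without a
    counterpart, since its image would have the two leaves j and j+1. *)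
Lemma span_flat_bump j k a x y : a j = 0 -> root_at a k j ->
  span (insert0 j a) (bump j.+1 x) (bump j.+1 y) -> span a x y.
Proof.
move=> aj [e v] [xy h vis]; rewrite !psum_bump in h.
split; first by move: xy; case: (bumpE j x) (bumpE j y) => -[-> ?] [] [-> ?]; lia.
  by move: xy h; case: (bumpE j x) (bumpE j y) => -[-> ?] [] [-> ?]; lia.
move=> r xry; have := vis (bump j.+1 r); rewrite !psum_bump.
have := vis (bump j.+1 j); rewrite !psum_bump; have := v x; move: xy h xry.
case: (bumpE j x) (bumpE j y) => -[-> ?] [] [-> ?];
  case: (bumpE j r) (bumpE j j) => -[-> ?] [] [-> ?]; try lia.
Qed.

Lemma span_flat_unbump j k a x y : a j = 0 -> root_at a k j ->
  span a x y -> span (insert0 j a) (bump j.+1 x) (bump j.+1 y) \/ (x = j /\ y = j.+1).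
Proof.
move=> aj rj sp; have [eq|neq] := eqVneq x j.
  by right; split=> //; rewrite eq in sp; rewrite (span_trivial aj sp).
left; have [xy h vis] := sp.
have [xj|jx] := ltnP x j.
  have yj := span_over_root rj sp xj.
  have bl z : z <= j -> bump j.+1 z = z by move=> zj; case: (bumpE j z); lia.
  have pl z : z <= j -> psum (insert0 j a) z = psum a z.
    by move=> zj; rewrite psum_insert0 leqW.
  rewrite !bl; try lia; split=> //; first by rewrite !pl; lia.
  by move=> r xry; have := vis r xry; rewrite !pl; lia.
split; first by case: (bumpE j x) (bumpE j y) => -[-> ?] [] [-> ?]; lia.
  by rewrite !psum_bump; case: (bumpE j x) (bumpE j y) => -[-> ?] [] [-> ?]; lia.
move=> r; have [->|rj'] := eqVneq r j.+1.
  by case: (bumpE j x) => -[-> ?]; lia.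
have er : bump j.+1 (unbump j.+1 r) = r by rewrite unbumpK // inE; apply/eqP.
have := vis (unbump j.+1 r); rewrite -er !psum_bump er.
have := bumpE j (unbump j.+1 r); rewrite er.
by case: (bumpE j x) (bumpE j y) => -[-> ?] [] [-> ?] [] [? ?]; lia.
Qed.

Lemma span_flat_in j k a x : a j = 0 -> root_at a k j ->
  span (insert0 j a) x j.+1 -> x = j.
Proof.
move=> aj rj sp; have [xj _ _] := sp; case: (ltngtP x j) => // [lt|]; last lia.
have rj' : root_at (insert0 j a) k j.
  by apply: root_at_eq rj => i ij; rewrite insert0_lt // ltnW.
by have := span_over_root rj' sp lt; lia.
Qed.

Lemma span_flat_out j a y : span (insert0 j a) j.+1 y -> y = j.+2.
Proof. by apply: span_trivial; rewrite insert0_eq. Qed.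

End Spans.

(** * Chains of free and paid steps *)

Section Levels.

Implicit Types (a b : nat -> nat) (W : seq nat).

(** [level R W q d]: q is the end of a chain from 0 of the following shape.  The
    first step is free and counts 1, then come steps to members of [W] that
    count nothing, then free steps that count 1 each; d is the total.  Paid steps
    are only possible from level 1, so they all precede the later free steps,
    as do the weighted vertices of a penalty tree. *)
Inductive level (R : nat -> nat -> Prop) W : nat -> nat -> Prop :=
| Level0 : level R W 0 0
| LevelS p q d : level R W p d -> R p q -> level R W q d.+1
| LevelW p q : level R W p 1 -> R p q -> q \in W -> level R W q 1.

Definition linked a b p q := span a p q \/ span b p q.

(** Paying for the members of W is enough: every type N caret is reached with at
    most n counted steps. *)
Definition sufficient n a b W :=
  forall s, 0 < s -> 0 < a s + b s -> exists2 d, d <= n & level (linked a b) W s d.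

Lemma linked_lt a b p q : linked a b p q -> p < q.
Proof. by case=> -[]. Qed.

Lemma linked_succ a b p : linked a b p p.+1.
Proof. by left; apply: span_succ. Qed.

Lemma level_pos (R : nat -> nat -> Prop) W q d : (forall p q, R p q -> p < q) ->
  level R W q d -> 0 < d -> 0 < q.
Proof.
by move=> Rlt [//|p r e _ Rpr _|p r _ Rpr _ _]; apply: leq_ltn_trans (Rlt _ _ Rpr).
Qed.

Lemma level_eq0 R W q : level R W q 0 -> q = 0.
Proof. by move e: 0 => d lq; case: lq e. Qed.

(** A relabelling that keeps or contracts links does not raise levels.  A link
    from level 0 to a paid caret becomes an ordinary first step. *)
Lemma level_sim (R R' : nat -> nat -> Prop) W W' (t : nat -> nat) q d :
  t 0 = 0 ->
  (forall p q, R p q -> t p = t q \/ R' (t p) (t q)) ->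
  (forall q, q \in W -> t q \in W') ->
  level R W q d -> exists2 d', d' <= d & level R' W' (t q) d'.
Proof.
move=> t0 tR tW; elim=> {q d} [|p q d _ [d' d'd IH] Rpq|p q _ [d' d'1 IH] Rpq Wq].
- by rewrite t0; exists 0 => //; apply: Level0.
- by case: (tR _ _ Rpq) => [<-|R'pq]; [exists d'; first lia | exists d'.+1;
    last apply: LevelS R'pq].
- case: (tR _ _ Rpq) => [<-|R'pq]; first by exists d'.
  exists 1 => //; case: d' d'1 IH => [|[|//]] _ IH; first exact: LevelS R'pq.
  exact: LevelW IH R'pq (tW _ Wq).
Qed.

Lemma level_sub (R R' : nat -> nat -> Prop) W W' q d :
  (forall p q, R p q -> R' p q) -> {subset W <= W'} -> level R W q d -> level R' W' q d.
Proof.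
move=> RR' WW'; elim=> {q d} [|p q d _ IH Rpq|p q _ IH Rpq Wq].
- exact: Level0.
- exact: LevelS IH (RR' _ _ Rpq).
- exact: LevelW IH (RR' _ _ Rpq) (WW' _ Wq).
Qed.

Lemma sub_cons (u : nat) W : {subset W <= u :: W}.
Proof. by move=> z Wz; rewrite inE Wz orbT. Qed.

(** Paying for the first caret that is reached at level 2 lowers everything that
    is reached through it. *)
Lemma level_pay R W q d : level R W q d.+2 -> exists u, level R (u :: W) q d.+1.
Proof.
move e: d.+2 => d2 lq; elim: lq d e => {q d2} // p q d' lp IH Rpq d [e].
case: d e => [|d] e; last first.
  by have [u lu] := IH d e; exists u; apply: LevelS Rpq.
exists q; rewrite -e in lp; apply: LevelW Rpq (mem_head _ _).
by apply: level_sub lp => //; apply: sub_cons.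
Qed.

Lemma level_all R W q : (forall p, R p p.+1) -> level R W q q.
Proof. by move=> RS; elim: q => [|q IH]; [apply: Level0 | apply: LevelS IH _]. Qed.

(** Walking along the roots uses one free step per tree. *)
Lemma level_root b a k q W : root_at a k q -> level (linked a b) W q k.
Proof.
elim: k q => [|k IH] q rq; first by rewrite (root_at_fun rq (root_at0 a)); apply: Level0.
have [q' rq' _] := root_at_below rq.
by apply: LevelS (IH _ rq') _; left; apply: span_root rq' rq.
Qed.

(** Links only appear.  The new caret makes q a type N caret, and q is the k-th
    root, hence within k <= n steps. *)
Lemma sufficient_incr n k a b q W B : vanish_from a B -> root_at a k q -> k <= n ->
  sufficient n a b W -> sufficient n (incr a q) b W.
Proof.
move=> aB rq kn gW s s0 ps.
have [q1 rq1] := root_at_exists k.+1 aB; have [q2 rq2] := root_at_exists k.+2 aB.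
have sub p r : linked a b p r -> linked (incr a q) b p r.
  by case=> sp; [left; apply/(span_incr _ _ rq rq1 rq2); left | right].
have [eq|neq] := eqVneq s q; last first.
  have [|d dn ls] := gW s s0; first by move: ps; rewrite /incr (negbTE neq) addn0.
  by exists d => //; apply: level_sub ls.
by exists k; rewrite ?eq //; apply: level_sub (level_root b W rq).
Qed.

(** Removing a root caret destroys the link from q to q2, which the detour through
    q1 replaces at the cost of one more step.  One payment compensates for it.
    If q = 0, pay for q2; if q has level 1, pay for q1; otherwise pay for the
    first caret of level 2 on a cheapest chain to q, which lowers q itself
    by 1. *)
Lemma sufficient_unincr n k a b q W B : vanish_from a B -> root_at a k q ->
  sufficient n (incr a q) b W -> exists u, sufficient n a b (u :: W).
Proof.
move=> aB rq gW.
have [q1 rq1] := root_at_exists k.+1 aB; have [q2 rq2] := root_at_exists k.+2 aB.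
have qq1 := root_at_mono rq rq1 (ltnSn _); have q1q2 := root_at_mono rq1 rq2 (ltnSn _).
have sp01 : linked a b q q1 by left; apply: span_root rq rq1.
have sp12 : linked a b q1 q2 by left; apply: span_root rq1 rq2.
have new p r : linked (incr a q) b p r -> linked a b p r \/ (p = q /\ r = q2).
  by case=> [/(span_incr _ _ rq rq1 rq2) []|]; [left; left | right | left; right].
have old W' z d : level (linked (incr a q) b) W' z d -> z <= q -> level (linked a b) W' z d.
  elim=> {z d} [_|p z d _ IH Rpz zq|p z _ IH Rpz Wz zq]; first exact: Level0.
    have pz := linked_lt Rpz; case: (new _ _ Rpz) => [R'pz|]; last lia.
    by apply: LevelS R'pz; apply: IH; lia.
  have pz := linked_lt Rpz; case: (new _ _ Rpz) => [R'pz|]; last lia.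
  by apply: LevelW R'pz Wz; apply: IH; lia.
suff [u hu] : exists u, forall z d, level (linked (incr a q) b) W z d ->
    exists2 d', d' <= d & level (linked a b) (u :: W) z d'.
  exists u => s s0 ps; have [|d dn /hu [d' d'd ls]] := gW s s0.
    by apply: leq_trans ps _; rewrite /incr; lia.
  by exists d' => //; lia.
(* d0 is the cheapest level of q; chains that reach q do not use the new link. *)
have ex : exists d, `[< level (linked (incr a q) b) W q d >].
  by exists q; apply/asboolP/level_all/linked_succ.
case: (ex_minnP ex) => d0 /asboolP lq0 d0min {ex}.
have d0le d : level (linked (incr a q) b) W q d -> d0 <= d by move=> /asboolP; apply: d0min.
have {}lq0 := old _ _ _ lq0 (leqnn _).
have gen u : (forall d, d0 <= d ->
  exists2 d', d' <= d.+1 & level (linked a b) (u :: W) q2 d') ->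
  (d0 = 1 -> q2 \in W -> exists2 d', d' <= 1 & level (linked a b) (u :: W) q2 d') ->
  forall z d, level (linked (incr a q) b) W z d ->
    exists2 d', d' <= d & level (linked a b) (u :: W) z d'.
  move=> h1 h2 z d; elim=> {z d} [|p z d lp [d' d'd IH] Rpz|p z lp [d' d'd IH] Rpz Wz].
  - by exists 0 => //; apply: Level0.
  - case: (new _ _ Rpz) => [R'pz|[ep ez]]; first by exists d'.+1 => //; apply: LevelS R'pz.
    by subst p z; apply: h1; apply: d0le.
  - case: (new _ _ Rpz) => [R'pz|[ep ez]].
      exists 1 => //; case: d' d'd IH => [|[|//]] _ IH; first exact: LevelS R'pz.
      by apply: LevelW IH R'pz _; apply: sub_cons.
    subst p z; apply: h2 => //.
    have := d0le _ lp; case: (posnP d0) => [d00|]; last lia.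
    rewrite d00 in lq0; have : 0 < q by apply: level_pos lp _ => // ? ?; apply: linked_lt.
    by rewrite (level_eq0 lq0).
have lsub (u z d : nat) : level (linked a b) W z d -> level (linked a b) (u :: W) z d.
  by apply: level_sub => //; apply: sub_cons.
case: d0 lq0 d0le d0min gen => [|[|d0]] lq0 d0le _ gen.
- exists q2; apply: gen => // d _; exists 1 => //.
  by apply: LevelW (mem_head _ _); last apply: sp12; apply: LevelS sp01; apply: lsub.
- exists q1.
  have l1 : level (linked a b) (q1 :: W) q1 1.
    by apply: LevelW (mem_head _ _); last apply: sp01; apply: lsub.
  apply: gen => [d d1|_ Wq2]; first by exists 2 => //; apply: LevelS l1 sp12.
  by exists 1 => //; apply: LevelW l1 sp12 _; apply: sub_cons.
- have [u lu] := level_pay lq0; exists u; apply: gen => // d d1.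
  by exists d0.+3 => //; apply: LevelS sp12; apply: LevelS sp01.
Qed.

Lemma linked_bump a b j k x y : a j = 0 -> root_at a k j ->
  linked a b x y -> linked (insert0 j a) (incr (insert0 j b) j) (bump j.+1 x) (bump j.+1 y).
Proof.
move=> aj rj [sp|sp]; last by right; apply/span_caret_bump.
case: (span_flat_unbump aj rj sp) => [sp'|[-> ->]]; first by left.
by right; apply/span_caret_bump/span_succ.
Qed.

(** [unbump j] identifies the deleted caret j+1 with j; the only links at j+1
    are those to its neighbours. *)
Lemma linked_unbump a b j k x y : a j = 0 -> root_at a k j ->
  linked (insert0 j a) (incr (insert0 j b) j) x y ->
  unbump j x = unbump j y \/ linked a b (unbump j x) (unbump j y).
Proof.
move=> aj rj lxy.
have [ex|nx] := eqVneq x j.+1.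
  subst x; have -> : y = j.+2.
    by case: lxy => [/span_flat_out|/span_caret_out].
  right; have -> : unbump j j.+1 = j by case: (unbumpE j j.+1); lia.
  have -> : unbump j j.+2 = j.+1 by case: (unbumpE j j.+2); lia.
  exact: linked_succ.
have [ey|ny] := eqVneq y j.+1.
  left; subst y; have -> : x = j.
    by case: lxy => [/(span_flat_in aj rj)|/span_caret_in].
  by case: (unbumpE j j.+1) (unbumpE j j) => -[? ?] [] [? ?]; lia.
right.
have e z : z != j.+1 -> z = bump j.+1 (unbump j z).
  by move=> nz; case: (unbumpE j z) (bumpE j (unbump j z)) => -[? ?] [] [? ?]; lia.
rewrite (e x nx) (e y ny) in lxy.
by case: lxy => [sp|/span_caret_bump sp]; [left; apply: span_flat_bump rj sp | right].
Qed.

Lemma sufficient_contract n a b j k W : a j = 0 -> root_at a k j ->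
  sufficient n (insert0 j a) (incr (insert0 j b) j) W ->
    sufficient n a b (map (unbump j) W).
Proof.
move=> aj rj gW s s0 ps.
have [||d dn ls] := gW (bump j.+1 s).
- by case: (bumpE j s) => -[-> ?]; lia.
- rewrite /incr; case: (bumpE j s) => -[-> sj]; first by rewrite !insert0_lt //; lia.
  by rewrite !insert0_gt //; lia.
have [|||d' d'd] := level_sim (t := unbump j) (R' := linked a b) (W' := map (unbump j) W) _ _ _ ls.
- by rewrite /unbump.
- by move=> p q; apply: linked_unbump rj.
- by move=> q; apply: map_f.
have -> : unbump j (bump j.+1 s) = s.
  by case: (bumpE j s) (unbumpE j (bump j.+1 s)) => -[-> ?] [] [? ?]; lia.
by exists d' => //; lia.
Qed.

(** The only new type N caret is j, which is the k-th root. *)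
Lemma sufficient_expand n a b j k W : a j = 0 -> root_at a k j -> k <= n ->
  sufficient n a b W -> sufficient n (insert0 j a) (incr (insert0 j b) j) (map (bump j.+1) W).
Proof.
move=> aj rj kn gW s s0 ps.
have [->|sj] := eqVneq s j.
  exists k => //; apply: level_root; apply: root_at_eq rj => i ij.
  by rewrite insert0_lt // ltnW.
have [s1|s1] := eqVneq s j.+1.
  by move: ps; rewrite s1 /incr !insert0_eq; lia.
have e : s = bump j.+1 (unbump j s).
  by case: (unbumpE j s) (bumpE j (unbump j s)) => -[? ?] [] [? ?]; lia.
have [||d dn ls] := gW (unbump j s).
- by case: (unbumpE j s); lia.
- move: ps; rewrite /incr (negbTE sj); case: (unbumpE j s) => -[es js].
    by rewrite es !insert0_lt //; lia.
  by rewrite [X in insert0 j a X]es [X in insert0 j b X]es !insert0_gt //; lia.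
have [|||d' d'd] := level_sim (t := bump j.+1) (R' := linked (insert0 j a) (incr (insert0 j b) j))
  (W' := map (bump j.+1) W) _ _ _ ls.
- by rewrite /bump.
- by move=> p q lpq; right; apply: linked_bump rj lpq.
- by move=> q; apply: map_f.
by rewrite -e; exists d' => //; lia.
Qed.

End Levels.

(** * A move that lowers the cost *)

Section Improvement.

Implicit Types (a b : nat -> nat) (W : seq nat).

Lemma level_ex a b W q : exists d, `[< level (linked a b) W q d >].
Proof. by exists q; apply/asboolP/level_all/linked_succ. Qed.

(** The cost of a cheapest chain to q; the step before q on such a chain is what
    [minstep] describes. *)
Definition minlevel a b W q := ex_minn (level_ex a b W q).

Lemma minlevelP a b W q : level (linked a b) W q (minlevel a b W q).
Proof. by rewrite /minlevel; case: ex_minnP => d /asboolP. Qed.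

Lemma minlevel_le a b W q d : level (linked a b) W q d -> minlevel a b W q <= d.
Proof. by rewrite /minlevel; case: ex_minnP => d' _ dmin /asboolP /dmin. Qed.

Definition minstep a b W r p :=
  minlevel a b W p = (minlevel a b W r).+1 \/
  [/\ minlevel a b W r = 1, p \in W & minlevel a b W p = 1].

Lemma minlevel_pred a b W p : 0 < p ->
  exists2 r, linked a b r p & minstep a b W r p.
Proof.
move=> p0; have := minlevelP a b W p.
move e: (minlevel a b W p) => d lp; case: lp e p0 => // {d p}.
- move=> r p d lr Rrp e _; exists r => //; left; rewrite e.
  have := minlevel_le (LevelS (minlevelP a b W r) Rrp).
  by have := minlevel_le lr; lia.
- move=> r p lr Rrp Wp e _; exists r => //.
  have := minlevel_le lr; rewrite leq_eqVlt => /orP [/eqP l1|l0]; first by right.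
  by left; rewrite e; lia.
Qed.

Definition decr a q := fun i => a i - (i == q).

Lemma decrK a q : 0 < a q -> incr (decr a q) q = a.
Proof.
move=> aq; apply: funext => i; rewrite /incr /decr.
by case: eqP => [->|_]; lia.
Qed.

Lemma root_at_incr a k q : root_at (incr a q) k q <-> root_at a k q.
Proof.
by split; apply: root_at_eq => i iq; rewrite /incr ltn_eqF ?addn0.
Qed.

Lemma root_at_incr_next a k q r : root_at a k q -> root_at a k.+2 r ->
  root_at (incr a q) k.+1 r.
Proof.
move=> [e v] [er vr]; split=> [|r' r'r]; rewrite psum_incr.
  have : q < r by case: (ltngtP q r) => // [rq|eq]; [have := v _ rq | subst r]; lia.
  by lia.
by have := vr _ r'r; have := v r'; case: (ltngtP r' q) => [|//|->]; lia.
Qed.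

(** The converse of [span_incr]: removing the root caret of the tree at q loses no
    link but the one that spans this tree. *)
Lemma linked_decr a b k q q1 B x y : vanish_from a B -> root_at a k q ->
  root_at a k.+1 q1 ->
  0 < a q -> linked a b x y -> linked (decr a q) b x y \/ (x = q /\ y = q1).
Proof.
move=> aB rq rq1 aq; have dB : vanish_from (decr a q) B by move=> i /aB;
  rewrite /decr => ->.
have rq' : root_at (decr a q) k q by apply/(root_at_incr _ k q); rewrite decrK.
have [r1 rr1] := root_at_exists k.+1 dB; have [r2 rr2] := root_at_exists k.+2 dB.
have := root_at_incr_next rq' rr2; rewrite decrK // => /(root_at_fun rq1) ->.
case=> [sp|]; last by left; right.
rewrite -{1}(decrK aq) in sp; case/(span_incr _ _ rq' rr1 rr2): sp => [sp|]; last by right.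
by left; left.
Qed.

(** If the cheapest chains to the vertices satisfying P stay inside P and avoid
    the lost link, then their levels do not change. *)
Lemma sufficient_remove n a b W k q q1 B (P : nat -> Prop) :
  vanish_from a B -> root_at a k q -> root_at a k.+1 q1 -> 0 < a q ->
  (forall s, 0 < s -> 0 < a s + b s -> P s) ->
  (forall p, P p -> minlevel a b W p <= n) ->
  (forall r p, P p -> linked a b r p -> minstep a b W r p -> P r /\ ~ (r = q /\ p = q1)) ->
  sufficient n (decr a q) b W.
Proof.
move=> aB rq rq1 aq PS Pn Pstep.
have main p : P p -> level (linked (decr a q) b) W p (minlevel a b W p).
  elim/ltn_ind: p => p IH Pp; have [->|p0] := posnP p.
    have -> : minlevel a b W 0 = 0 by apply/eqP; rewrite -leqn0; apply/minlevel_le/Level0.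
    exact: Level0.
  have [r Rrp st] := minlevel_pred a b W p0; have [Pr ne] := Pstep _ _ Pp Rrp st.
  have lr := IH _ (linked_lt Rrp) Pr.
  have [R'|//] := linked_decr aB rq rq1 aq Rrp.
  case: st => [->|[er Wp ->]]; first exact: LevelS lr R'.
  by rewrite er in lr; apply: LevelW lr R' Wp.
move=> s s0 ps; have Ps : P s by apply: PS => //; move: ps; rewrite /decr; lia.
by exists (minlevel a b W s); [apply: Pn | apply: main].
Qed.

(** The maximal run of single leaves among the trees that end with the K-th one:
    it begins at the first leaf or right after a nontrivial tree. *)
Lemma trivial_run a (rt : nat -> nat) K : (forall k, root_at a k (rt k)) -> a (rt K) = 0 ->
  exists m, [/\ m <= K, forall i, rt m <= i <= rt K -> a i = 0
    & m = 0 \/ exists2 k, m = k.+1 & 0 < a (rt k)].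
Proof.
move=> rtP; elim: K => [|K IH] aK.
  exists 0; split=> // [i|]; last by left.
  by rewrite -eqn_leq => /eqP <-.
have [aK0|aKpos] := posnP (a (rt K)).
  have eK := root_at_fun (rtP K.+1) (root_at_succ (rtP K) aK0).
  have [m [mK flat hm]] := IH aK0; exists m; split=> // [|i]; first exact: leqW.
  by have [->|ne] := eqVneq i (rt K.+1); last (move=> hi; apply: flat; lia).
exists K.+1; split=> // [i|]; last by right; exists K.
by rewrite -eqn_leq => /eqP <-.
Qed.

(** Each alternative is a generator that lowers m + 2 |W| by 1: removing a root
    caret, cancelling against an exposed caret of [b], or adding a caret on the
    first two trees, which makes the payment for w superfluous. *)
Lemma improving_move n a b W B : 0 < n -> vanish_from a B -> sufficient n a b W ->
  (exists i, 0 < a i + b i) ->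
  [\/ exists k q, [/\ k <= n, root_at a k q, 0 < a q & sufficient n (decr a q) b W],
      exists k j, [/\ k <= n, root_at a k j, a j + a j.+1 = 0, 0 < b j & b j.+1 = 0]
    | exists2 w, w \in W & sufficient n (incr a 0) b (rem w W)].
Proof.
move=> n0 aB gW [i0 nz].
have [rt rtP] := boolp.choice (fun k => root_at_exists k aB).
pose d := minlevel a b W.
have d0 : d 0 = 0 by apply/eqP; rewrite -leqn0; apply/minlevel_le/Level0.
have dpos p : 0 < p -> 0 < d p.
  move=> p0; rewrite lt0n; apply/eqP => dp.
  by have := minlevelP a b W p; rewrite -/(d p) dp => /level_eq0; lia.
have rt0 : rt 0 = 0 := root_at_fun (rtP 0) (root_at0 a).
have drt k : d (rt k) <= k by apply/minlevel_le/level_root.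
have rtlt k l : k < l -> rt k < rt l by apply: root_at_mono.
have dS s : 0 < s -> 0 < a s + b s -> d s <= n.
  by move=> s0 /(gW _ s0) [e en /minlevel_le]; rewrite -/(d s); lia.
have stepd r p : minstep a b W r p -> d r <= d p.
  by rewrite /minstep -!/(d _) => -[->|[-> _ ->]].
(* K is the first root from which walking to the next root is not cheapest,
   or n + 1 if there is none in reach; so the K-th root has level K. *)
have exK : exists K, (K == n.+1) || (d (rt K.+1) <= K) by exists n.+1; rewrite eqxx.
case: (ex_minnP exK) => K KP Kmin {exK}.
have Kn : K <= n.+1 by apply: Kmin; rewrite eqxx.
have K0 : 0 < K.
  rewrite lt0n; apply/eqP => eK; move: KP; rewrite eK /= leqNgt dpos //.
  by apply: leq_ltn_trans (rtlt 0 1 isT).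
have rtK0 : 0 < rt K by apply: leq_ltn_trans (rtlt 0 K K0).
have dK : d (rt K) = K.
  case: K {KP rtK0} Kmin Kn K0 => // K Kmin Kn _; apply/eqP; rewrite eqn_leq drt /= ltnNge.
  by apply/negP => h; have := Kmin K; rewrite h orbT => /(_ isT); rewrite ltnn.
have [/andP [/eqP K1 W2]|notC3] := boolP ((K == 1) && (rt 2 \in W)).
  apply: Or33; exists (rt 2) => // s s0 ps.
  have sp2 : span (incr a 0) 0 (rt 2).
    rewrite -{1 2}rt0; apply/(span_incr _ _ (rtP 0) (rtP 1) (rtP 2)); by right; rewrite rt0.
  have sub p r : linked a b p r -> linked (incr a 0) b p r.
    by case=> sp; [left; rewrite -rt0; apply/(span_incr _ _ (rtP 0) (rtP 1) (rtP 2));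
      left | right].
  have [e en ls] : exists2 e, e <= n & level (linked a b) W s e.
    have [es|ne] := eqVneq s 0; first by rewrite es in s0.
    by apply: gW => //; move: ps; rewrite /incr (negbTE ne) addn0.
  suff [e' e'e ls'] : exists2 e', e' <= e & level (linked (incr a 0) b) (rem (rt 2) W) s e'.
    by exists e' => //; lia.
  elim: {s s0 ps en} ls => [|p q e'' _ [e' le IH] Rpq|p q _ [e' le IH] Rpq Wq].
  - by exists 0 => //; apply: Level0.
  - by exists e'.+1 => //; apply: LevelS IH (sub _ _ Rpq).
  exists 1 => //; have [->|ne] := eqVneq q (rt 2).
    by apply: LevelS (Level0 _ _) _; left.
  case: e' le IH => [|[|//]] _ IH; first exact: LevelS IH (sub _ _ Rpq).
  apply: LevelW IH (sub _ _ Rpq) _.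
  have := perm_to_rem W2; move/perm_mem/(_ q); rewrite Wq inE (negbTE ne) /= => <- //.
(* No cheapest chain within reach goes from the K-th root to the next one. *)
have X p : d p <= n -> p = rt K.+1 -> minstep a b W (rt K) p -> False.
  move=> dpn ep; rewrite /minstep -!/(d _) dK => -[dp|[eK Wp dp]].
    case/orP: KP => [/eqP eK|]; last by rewrite -ep dp ltnn.
    by rewrite dp in dpn; lia.
  case/negP: notC3; rewrite eK eqxx /=; move: Wp; rewrite ep; by rewrite eK.
have [aK|aK] := posnP (a (rt K)); last first.
  have KN : K <= n.
    rewrite leqNgt; apply/negP => nK.
    by have := dS _ rtK0; rewrite dK addn_gt0 aK => /(_ isT); lia.
  apply: Or31; exists K, (rt K); split=> //.
  apply: (@sufficient_remove n a b W K (rt K) (rt K.+1) B (fun p => d p <= n)) => //.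
  move=> r p dp Rrp st; split; first by have := stepd _ _ st; lia.
  by case=> er ep; subst r; apply: X st.
have eK : rt K.+1 = (rt K).+1 := root_at_fun (rtP K.+1) (root_at_succ (rtP K) aK).
(* The next root is reached over the K-th one by a span of b, or else the K-th
   root is out of reach; in both cases no caret of b starts there. *)
have bK : b (rt K) = 0.
  case/orP: KP => [/eqP eKn|dle].
    apply/eqP; rewrite -leqn0 leqNgt; apply/negP => bpos.
    have := dS _ rtK0; rewrite addn_gt0 bpos orbT dK => /(_ isT); lia.
  have [KN|eKn] : K <= n \/ K = n.+1 by lia.
    have [c Rc st] := minlevel_pred a b W (ltn0Sn (rt K)).
    have ne : c <> rt K by move=> ec; subst c; apply: X st => //; rewrite -eK; lia.
    have ck : c < rt K by have := linked_lt Rc; lia.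
    case: Rc => sp; last exact: span_last sp ck.
    by have := span_over_root (rtP K) sp ck; lia.
  apply/eqP; rewrite -leqn0 leqNgt; apply/negP => bpos.
  have := dS _ rtK0; rewrite addn_gt0 bpos orbT dK => /(_ isT); lia.
have [m [mK flat hm]] := trivial_run rtP aK.
have [[s sZ bs]|bZ] := pselect (exists2 s, rt m <= s <= rt K & 0 < b s).
  have sK : s < rt K.
    by case: (ltngtP s (rt K)) => // [|es]; [lia | move: bs; rewrite es bK].
  have [j [sj jK bj bj1]] := exposed_in bs sK bK.
  apply: Or32; exists (m + (j - rt m)), j.
  have rj : root_at a (m + (j - rt m)) j.
    have {2}-> : j = rt m + (j - rt m) by lia.
    by apply: root_at_add => // i hi; apply: flat; lia.
  split=> //; last by rewrite !flat //; lia.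
  have : m + (j - rt m) < K; last lia.
  case: (ltngtP (m + (j - rt m)) K) => // [lt|e].
    by have := root_at_mono (rtP K) rj lt; lia.
  by rewrite e in rj; have := root_at_fun rj (rtP K); lia.
have {}bZ i : rt m <= i <= rt K -> b i = 0.
  by move=> iZ; apply/eqP; rewrite -leqn0 leqNgt; apply/negP => bi; apply: bZ; exists i.
(* Inside the run all links are trivial, so a chain that enters it can only
   leave it through the K-th root, which X forbids. *)
pose P p := ~~ (rt m <= p <= rt K) && (d p <= n).
have Pstep r p : P p -> linked a b r p -> minstep a b W r p -> P r.
  case/andP=> pZ dp Rrp st; apply/andP; split; last by have := stepd _ _ st; lia.
  apply/negP => rZ.
  have ep : p = r.+1 by case: Rrp; apply: span_trivial; [apply: flat | apply: bZ].
  have er : r = rt K by lia.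
  by apply: (X p) => //; [rewrite eK ep er | rewrite -er].
have PS s : 0 < s -> 0 < a s + b s -> P s.
  move=> s0 ps; apply/andP; split; last exact: dS.
  by apply/negP => sZ; move: ps; rewrite flat // bZ.
case: hm => [m0|[k em ak]].
  have noP p : P p -> False.
    elim/ltn_ind: p => p IH Pp; have [p0|p0] := posnP p.
      by move: Pp; rewrite /P p0 m0 rt0.
    have [r Rrp st] := minlevel_pred a b W p0.
    by apply: (IH r); [apply: linked_lt Rrp | apply: Pstep st].
  have [i00|i00] := posnP i0; last by have := noP _ (PS _ i00 nz).
  by move: nz; rewrite i00 flat ?bZ // m0 rt0.
apply: Or31; exists k, (rt k); split=> //; first lia.
apply: (@sufficient_remove n a b W k (rt k) (rt k.+1) B P) => //.
  by move=> p /andP [].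
move=> r p Pp Rrp st; split; first exact: Pstep st.
case=> _ ep; move: Pp; rewrite /P ep -em.
have : rt m <= rt K; last by move=> ->; rewrite leqnn.
by case: (ltngtP m K) mK => // [/rtlt/ltnW|->].
Qed.

End Improvement.

(** * Elements of F and pairs of exponent sequences *)

Section Representation.

Implicit Types (a b : nat -> nat) (W : seq nat).

Local Open Scope group_scope.

Lemma FclassM u v : Fclass u * Fclass v = Fclass (u ++ v).
Proof. exact: FmulE. Qed.

Lemma Fclass_nil : Fclass [::] = 1.
Proof. by []. Qed.

Lemma x_V k : (x_ k)^-1 = Fclass [:: (k, true)].
Proof.
apply: mulg1_eq; rewrite FclassM; apply/FclassP.
exact: (Feq_cancel (k, false)).
Qed.

Lemma x_swap i j : i < j -> x_ j * x_ i = x_ i * x_ j.+1.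
Proof.
move=> ij; have /FclassP := Feq_rel ij; rewrite -[Fclass [:: (j.+1, _)]]/(x_ j.+1) => <-.
by rewrite -[[:: _; _; _]]/([:: (i, true)] ++ [:: (j, false)] ++ [:: (i, false)])
  -!FclassM -x_V mulVKg.
Qed.

Lemma x_swapX i k e : i < k -> x_ k * x_ i ^+ e = x_ i ^+ e * x_ (k + e).
Proof.
move=> ik; elim: e => [|e IH]; first by rewrite expg0 mulg1 mul1g addn0.
by rewrite expgSr mulgA IH -mulgA x_swap ?addnS ?mulgA //; lia.
Qed.

(** The product over the exponents of the leaves i, ..., i+n-1; with i = 0 and n
    large this is the positive element given by the forest. *)
Definition forest_word a i n := \prod_(k <- iota i n) x_ k ^+ a k.

Lemma forest_word0 a i : forest_word a i 0 = 1.
Proof. by rewrite /forest_word big_nil. Qed.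

Lemma forest_word_cons a i n : forest_word a i n.+1 = x_ i ^+ a i * forest_word a i.+1 n.
Proof. by rewrite /forest_word big_cons. Qed.

Lemma forest_word_cat a i m n : forest_word a i (m + n) =
  forest_word a i m * forest_word a (i + m) n.
Proof. by rewrite /forest_word iotaD big_cat. Qed.

Lemma forest_word_rcons a i n : forest_word a i n.+1 =
  forest_word a i n * x_ (i + n) ^+ a (i + n).
Proof. by rewrite -addn1 forest_word_cat forest_word_cons forest_word0 mulg1. Qed.

Lemma eq_forest_word a b i n : (forall k, i <= k < i + n -> a k = b k) ->
  forest_word a i n = forest_word b i n.
Proof. by move=> eqab; apply: eq_big_seq => k; rewrite mem_iota => /eqab ->. Qed.

Lemma forest_word_vanish a B i n n' : vanish_from a B -> B <= i + n -> n <= n' ->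
  forest_word a i n' = forest_word a i n.
Proof.
move=> aB Bn /subnKC <-; rewrite forest_word_cat.
have -> : forest_word a (i + n) (n' - n) = 1; last by rewrite mulg1.
by rewrite /forest_word big_seq big1 // => k; rewrite mem_iota => h; rewrite aB //; lia.
Qed.

(** Moving x_k to the right past the powers x_0, x_1, ... raises its index by the
    exponents that it passes, as long as the current index is the larger one;
    at the k-th root the two indices meet. *)
Lemma x_forest_word a k p : (forall r, r < p -> r < k + psum a r) ->
  x_ k * forest_word a 0 p = forest_word a 0 p * x_ (k + psum a p).
Proof.
elim: p => [|p IH] h; first by rewrite forest_word0 psum0 mulg1 mul1g addn0.
rewrite forest_word_rcons mulgA IH; last by move=> r rp; apply: h; lia.
by rewrite -mulgA x_swapX ?h // -!mulgA psumS addnA.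
Qed.

Lemma forest_word_incr a k q N : root_at a k q -> q < N -> forest_word (incr a q) 0 N =
  x_ k * forest_word a 0 N.
Proof.
move=> [e v] /subnKC <-; rewrite addSnnS !forest_word_cat !forest_word_cons.
rewrite !mulgA x_forest_word // -e add0n.
have -> : forest_word (incr a q) 0 q = forest_word a 0 q.
  by apply: eq_forest_word => i hi; rewrite /incr ltn_eqF ?addn0.
have -> : forest_word (incr a q) q.+1 (N - q.+1) = forest_word a q.+1 (N - q.+1).
  by apply: eq_forest_word => i hi; rewrite /incr gtn_eqF ?addn0 //; lia.
by rewrite /incr eqxx addn1 expgS -!mulgA.
Qed.

(** The relation x_i x_j = x_j x_(i+1) for j < i, applied to a whole block. *)
Lemma forest_word_shift a b j i n : j < i -> (forall m, i <= m -> b m.+1 = a m) ->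
  forest_word a i n * x_ j = x_ j * forest_word b i.+1 n.
Proof.
elim: n i => [|n IH] i ji ab; first by rewrite !forest_word0 mulg1 mul1g.
rewrite !forest_word_cons -mulgA IH; [|lia|by move=> m im; apply: ab; lia].
rewrite !mulgA ab //; congr (_ * _).
elim: (a i) => [|e IHe]; first by rewrite !expg0 mulg1 mul1g.
by rewrite expgS -mulgA IHe mulgA x_swap // -mulgA -expgS.
Qed.

Lemma forest_word_insert a j N : j < N -> forest_word (incr (insert0 j a) j) 0 N.+1 =
  forest_word a 0 N * x_ j.
Proof.
move=> /subnKC <-; rewrite addSnnS -addnS !forest_word_cat !forest_word_cons !add0n.
rewrite -!mulgA (@forest_word_shift _ (incr (insert0 j a) j)) //; last first.
  by move=> m jm; rewrite /incr insert0_gt //; lia.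
have -> : forest_word (incr (insert0 j a) j) 0 j = forest_word a 0 j.
  by apply: eq_forest_word => i hi; rewrite /incr insert0_lt ?ltn_eqF ?addn0 //; lia.
rewrite /incr insert0_lt // eqxx addn1 expgSr insert0_eq.
have -> : 0 + (j.+1 == j) = 0 by lia.
by rewrite expg0 mul1g -!mulgA.
Qed.

(** g is the product of the positive element of [b] and the inverse of that of [a],
    and m is the total number of carets of the two forests.  The bound N
    is not fixed, since moves change the number of leaves. *)
Definition represents a b (g : F) m := exists2 N, vanish_from a N /\ vanish_from b N
  & g = forest_word b 0 N * (forest_word a 0 N)^-1 /\ m = psum a N + psum b N.

Lemma representsP a b g m N : vanish_from a N -> vanish_from b N ->
  represents a b g m <-> g = forest_word b 0 N * (forest_word a 0 N)^-1 /\ m =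
    psum a N + psum b N.
Proof.
move=> aN bN; split=> [[N' [aN' bN'] [-> ->]]|h]; last by exists N.
have [le|le] := leqP N N'.
  by rewrite -(psum_vanish aN le) -(psum_vanish bN le) -(forest_word_vanish aN _ le) //
    -(forest_word_vanish bN _ le).
have {}le := ltnW le.
by rewrite -(psum_vanish aN' le) -(psum_vanish bN' le) -(forest_word_vanish aN' _ le) //
  -(forest_word_vanish bN' _ le).
Qed.

Lemma represents_supp a b g m : represents a b g m -> exists N, forall N', N <= N' ->
  vanish_from a N' /\ vanish_from b N'.
Proof.
case=> N [aN bN] _; exists N => N' NN'; split=> i Ni; [apply: aN|apply: bN]; lia.
Qed.

Lemma vanish_le a B B' : B <= B' -> vanish_from a B -> vanish_from a B'.
Proof. by move=> le aB i Bi; apply: aB; lia. Qed.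

(** Multiplying by the inverse of x_k adds a caret on the k-th root of the
    denominator. *)
Lemma represents_incr a b k q g m : root_at a k q -> 
  represents a b g m <-> represents (incr a q) b (g * (x_ k)^-1) m.+1.
Proof.
move=> rq.
have key N : q < N -> vanish_from a N -> vanish_from b N ->
    (represents a b g m <-> represents (incr a q) b (g * (x_ k)^-1) m.+1).
  move=> qN aN bN; have iN : vanish_from (incr a q) N.
    by move=> i Ni; rewrite /incr aN // gtn_eqF //; lia.
  rewrite (representsP _ _ aN bN) (representsP _ _ iN bN).
  rewrite (forest_word_incr rq qN) psum_incr qN invgM mulgA.
  split=> -[e1 e2]; first by rewrite e1 e2; split=> //; lia.
  by split; [apply: mulIg e1 | lia].
split=> r; have [N [aN bN] _] := r.
  by apply/(key (N + q).+1) => //; [lia | apply: vanish_le aN; lia | apply: vanish_le bN;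
    lia].
apply/(key (N + q).+1) => //; [lia | | apply: vanish_le bN; lia].
by move=> i Ni; have := aN i; rewrite /incr; lia.
Qed.

(** A caret hung under leaf j of both forests cancels.  When leaf j is the k-th
    tree of [a], the copy in [a] is a root caret, so multiplying by x_k
    removes it again and only the copy in [b] remains. *)
Lemma represents_insert a b j k g m : a j = 0 -> root_at a k j ->
  represents a b g m -> represents (insert0 j a) (incr (insert0 j b) j) (g * x_ k) m.+1.
Proof.
move=> aj rj [N [aN bN] [-> ->]].
have rj' : root_at (insert0 j a) k j.
  by apply: root_at_eq rj => i ij; rewrite insert0_lt // ltnW.
apply/(represents_incr _ _ _ rj'); rewrite mulgK.
have le : N <= N + j.+1 by lia.
have jN : j < N + j.+1 by lia.
rewrite -(forest_word_vanish aN _ le) // -(forest_word_vanish bN _ le) //.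
rewrite -(psum_vanish aN le) -(psum_vanish bN le).
have key a' : vanish_from a' N -> vanish_from (incr (insert0 j a') j) (N + j.+1).+1.
  by move=> a'N [//|i] hi; rewrite /incr insert0_gt ?a'N //; lia.
exists (N + j.+1).+1; first by split; apply: key.
rewrite !forest_word_insert // invgM mulgA mulgK; split=> //.
rewrite !psum_incr !psum_insert0.
have -> : ((N + j.+1).+1 <= j.+1) = false by lia.
rewrite /=; lia.
Qed.

End Representation.

(** * Words in the generators *)

Section Words.

Implicit Types (a b : nat -> nat) (W : seq nat).

Local Open Scope group_scope.

(** No caret is exposed at the same leaf in both forests: an exposed caret at i
    means that the exponent of i is positive and that of i+1 is 0. *)
Definition reduced a b := forall i, 0 < a i -> 0 < b i -> 0 < a i.+1 + b i.+1.

Lemma represents_fun a b g g' m m' : represents a b g m -> represents a b g' m' -> g =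
  g' /\ m = m'.
Proof. by move=> [N [aN bN] [-> ->]] /(representsP _ _ aN bN) [-> ->]. Qed.

Lemma represents_total a b N : vanish_from a N -> vanish_from b N ->
  exists g m, represents a b g m.
Proof. by move=> aN bN; do 2!eexists; exists N. Qed.

(** The inverse of [represents_insert]. *)
Lemma represents_delete a b j k g m : a j = 0 -> a j.+1 = 0 -> 0 < b j -> b j.+1 = 0 ->
  root_at a k j -> represents a b g m ->
  exists a1 b1, [/\ a = insert0 j a1, b = incr (insert0 j b1) j, root_at a1 k j, a1 j = 0
    & exists2 m1, m = m1.+1 & represents a1 b1 (g * (x_ k)^-1) m1].
Proof.
move=> aj aj1 bj bj1 rj r.
pose a1 := fun i => a (bump j.+1 i); pose b1 := fun i => decr b j (bump j.+1 i).
have ea : a = insert0 j a1 by rewrite insert0K.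
have eb : b = incr (insert0 j b1) j.
  by rewrite insert0K ?decrK // /decr bj1.
have low i : i <= j -> bump j.+1 i = i by move=> ij; case: (bumpE j i); lia.
have rj1 : root_at a1 k j.
  by apply: root_at_eq rj => i ij; rewrite /a1 low // ltnW.
have aj0 : a1 j = 0 by rewrite /a1 low.
exists a1, b1; split=> //.
have [N [aN bN] _] := r.
have a1N : vanish_from a1 N by move=> i Ni; apply: aN; case: (bumpE j i) => -[-> ?]; lia.
have b1N : vanish_from b1 N.
  move=> i Ni; have : b (bump j.+1 i) = 0 by apply: bN; case: (bumpE j i) => -[-> ?]; lia.
  by rewrite /b1 /decr => ->.
have [g1 [m1 r1]] := represents_total a1N b1N.
have := represents_insert aj0 rj1 r1; rewrite -ea -eb => /(represents_fun r) [-> ->].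
by exists m1 => //; rewrite mulgK.
Qed.

(** The cost m + 2 |W| is 1-Lipschitz along the Cayley graph.  Reducedness survives
    each move because the exponent just before a root is 0. *)
Lemma represents_step n a b g m W k (e : bool) : k <= n -> represents a b g m ->
  reduced a b -> sufficient n a b W ->
  exists a' b' m' W', [/\ represents a' b' (g * (if e then x_ k else (x_ k)^-1)) m',
    reduced a' b', sufficient n a' b' W' & m' + 2 * size W' <= (m + 2 * size W).+1].
Proof.
move=> kn r red gW; have [N [aN bN] _] := r.
have [q rq] := root_at_exists k aN.
have pred0 i : i.+1 = q -> a i = 0 by move=> iq; rewrite -iq in rq; apply: root_at_pred0 rq.
case: e; last first.
- have [ired|nred] := pselect (reduced (incr a q) b).
    exists (incr a q), b, m.+1, W; split=> //; first by apply/(represents_incr _ _ _ rq).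
    exact: sufficient_incr aN rq kn gW.
  have [[aq aq1] [bq bq1]] : (a q = 0 /\ a q.+1 = 0) /\ (0 < b q /\ b q.+1 = 0).
    apply: contrapT => h; apply: nred => i; rewrite /incr.
    have [->|ne] := eqVneq i q.
      move=> _ bq; rewrite gtn_eqF // addn0 lt0n; apply/eqP => e; apply: h.
      split; split=> //; try lia.
      apply/eqP; rewrite -leqn0 leqNgt; apply/negP => aq.
      by have := red q aq bq; lia.
    by rewrite addn0 => ai bi; have := red i ai bi; lia.
  have [a1 [b1 [ea eb rq1 a1q [m1 em r1]]]] := represents_delete aq aq1 bq bq1 rq r.
  exists a1, b1, m1, (map (unbump q) W); split=> //; last by rewrite size_map; lia.
    move=> i; have [iq|qi] := ltnP i q.
      have := red i; rewrite ea eb /incr !(insert0_lt, ltn_eqF iq) //; try lia.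
      rewrite !addn0 => h ai bi; have := h ai bi; case: (eqVneq i.+1 q) => [e|ne];
        last by lia.
      by have := pred0 _ e; rewrite ea insert0_lt; lia.
    have [->|ne] := eqVneq i q; first by rewrite a1q.
    have := red i.+1; rewrite ea eb /incr !insert0_gt; lia.
  by rewrite ea eb in gW; apply: sufficient_contract rq1 gW.
have [aq|aq] := posnP (a q).
  exists (insert0 q a), (incr (insert0 q b) q), m.+1, (map (bump q.+1) W).
  split; [exact: represents_insert | | exact: sufficient_expand kn gW |
    by rewrite size_map].
  move=> i; rewrite /incr; have [iq|qi] := ltnP i q.
    rewrite !insert0_lt; try lia.
    by rewrite ltn_eqF // addn0 => ai bi; have := red i ai bi; lia.
  have [->|ne] := eqVneq i q; first by rewrite insert0_lt ?aq.
  have [->|ne1] := eqVneq i q.+1; first by rewrite insert0_eq.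
  case: i qi ne ne1 => [|i] qi ne ne1; first lia.
  rewrite !insert0_gt; try lia.
  by move=> ai bi; have := red i ai; lia.
have dK := decrK aq.
have rq' : root_at (decr a q) k q by apply/(root_at_incr _ k q); rewrite dK.
have dN : vanish_from (decr a q) N by move=> i /aN; rewrite /decr => ->.
have [u gu] : exists u, sufficient n (decr a q) b (u :: W).
  by apply: sufficient_unincr dN rq' _; rewrite dK.
have [g1 [m1 r1]] := represents_total dN bN.
have := r1; move/(represents_incr _ _ _ rq'); rewrite dK => /(represents_fun r) [-> em].
exists (decr a q), b, m1, (u :: W); split=> //; first by rewrite mulgVK.
  move=> i; rewrite /decr => ai bi; have := red i; case: (eqVneq i.+1 q) => [e|ne];
    last by lia.
  by move: ai; rewrite pred0.
by rewrite /=; lia.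
Qed.

Definition gen_word n (s : seq F) := forall y, y \in s -> X_ n y \/ X_ n y^-1.

Lemma gen_letter n y : X_ n y \/ X_ n y^-1 ->
  exists k e, k <= n /\ y = (if e then x_ k else (x_ k)^-1).
Proof.
case=> -[k /= kn e]; exists k; first by exists true.
by exists false; rewrite e invgK.
Qed.

(** Induction along the word, starting from the empty forests. *)
Lemma represents_of_word n s : gen_word n s ->
  exists a b m W, [/\ represents a b (\prod_(y <- s) y) m, reduced a b, sufficient n a b W
    & m + 2 * size W <= size s].
Proof.
elim/last_ind: s => [|s y IH] gs.
  exists (fun=> 0), (fun=> 0), 0, [::]; split=> //.
  exists 0 => //; split; first by rewrite big_nil !forest_word0 mulgV.
  by rewrite psum0.
have [|a [b [m [W [r red gW le]]]]] := IH.
  by move=> z zs; apply: gs; rewrite mem_rcons inE zs orbT.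
have [|k [e [kn ey]]] := @gen_letter n y; first by apply: gs; rewrite mem_rcons mem_head.
have [a' [b' [m' [W' [r' red' gW' le']]]]] := represents_step e kn r red gW.
exists a', b', m', W'; split=> //; last by rewrite size_rcons; lia.
by rewrite big_rcons /= ey.
Qed.

(** Induction on the cost, undoing one improving move at a time. *)
Lemma word_of_sufficient n a b g m W : 0 < n -> represents a b g m -> sufficient n a b W ->
  exists s, [/\ gen_word n s, \prod_(y <- s) y = g & size s <= m + 2 * size W].
Proof.
move=> n0; move e: (m + 2 * size W) => M.
elim/ltn_ind: M a b g m W e => M IH a b g m W eM r gW.
have [N [aN bN] [eg em]] := r.
have [nz|z] := pselect (exists i, 0 < a i + b i); last first.
  have ab0 i : a i = 0 /\ b i = 0.
    suff : ~ 0 < a i + b i by lia.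
    by move=> h; apply: z; exists i.
  exists [::]; split=> //; rewrite big_nil eg.
  have p1 c : (forall i, c i = 0) -> forest_word c 0 N = 1.
    by move=> c0; rewrite /forest_word big1 // => i _; rewrite c0.
  by rewrite !p1 ?mulgV // => i; case: (ab0 i).
have ext k (e : bool) a' b' m' W' : k <= n -> represents a' b' (g * (if e then x_ k else
  (x_ k)^-1)) m' ->
    sufficient n a' b' W' -> m' + 2 * size W' < M ->
    exists s, [/\ gen_word n s, \prod_(y <- s) y = g & size s <= M].
  move=> kn r' gW' lt; have [s [gs es les]] := IH _ lt _ _ _ _ _ erefl r' gW'.
  exists (rcons s (if e then (x_ k)^-1 else x_ k)); split.
  - move=> y; rewrite mem_rcons inE => /orP [/eqP ->|]; last exact: gs.
    by case: (e); [right; rewrite invgK | left]; exists k.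
  - by rewrite big_rcons /= es; case: (e); rewrite -mulgA ?mulgV ?mulVg mulg1.
  - by rewrite size_rcons; lia.
case: (improving_move n0 aN gW nz) => [[k [q [kn rq aq gW']]]|[k [j [kn rj aj bj bj1]]]|[w Ww gW']].
- have dN : vanish_from (decr a q) N by move=> i /aN; rewrite /decr => ->.
  have rq' : root_at (decr a q) k q by apply/(root_at_incr _ k q); rewrite decrK.
  have [g1 [m1 r1]] := represents_total dN bN.
  have := r1; move/(represents_incr _ _ _ rq'); rewrite decrK //
    => /(represents_fun r) [eg1 em1].
  apply: (ext k true (decr a q) b m1 W) => //; last lia.
  by rewrite eg1 mulgVK.
- have [||a1 [b1 [ea eb rq1 a1q [m1 em1 r1]]]] := represents_delete _ _ bj bj1 rj r;
    [lia|lia|].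
  apply: (ext k false a1 b1 m1 (map (unbump j) W)) => //; last by rewrite size_map; lia.
  by rewrite ea eb in gW; apply: sufficient_contract rq1 gW.
- apply: (ext 0 false (incr a 0) b m.+1 (rem w W)) => //.
    by apply/(represents_incr _ _ _ (root_at0 a)).
  by have := size_rem Ww; case: (W) Ww eM => //= *; lia.
Qed.

End Words.

(** * Uniqueness of the reduced pair *)

Section Uniqueness.

Implicit Types (a b : nat -> nat) (W : seq nat).

Local Open Scope group_scope.

(** A right action on pairs (tree, place in the tree), where the binary digits of
    the place, least significant first, say whether to go left or right
    at each caret: x_k splits the tree k, consuming one digit. *)
Definition act1 (p : nat * nat) (l : letter) : nat * nat :=
  let: (i, s) := p in let: (k, e) := l in
  if i < k then (i, s)
  else if e then
    if i == k then (k, s.*2) else if i == k.+1 then (k, s.*2.+1) else (i.-1, s)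
  else if i == k then (k + odd s, s./2) else (i.+1, s).

Definition act (w : word) (p : nat * nat) := foldl act1 p w.

Lemma act_cat u v p : act (u ++ v) p = act v (act u p).
Proof. exact: foldl_cat. Qed.

Lemma act_cancel l p : act [:: l; linv l] p = p.
Proof.
case: l p => k [] [i s]; rewrite /act /=.
- have [ik|ki] := ltnP i k; first by rewrite /= ik.
  have [->|ne] := eqVneq i k; first by rewrite /= ltnn eqxx odd_double doubleK addn0.
  have [->|ne'] := eqVneq i k.+1.
    by rewrite /= ltnn eqxx odd_double uphalf_double addn1.
  rewrite /=; have -> : (i.-1 < k) = false by lia.
  have -> : (i.-1 == k) = false by lia.
  by rewrite prednK //; lia.
- have [ik|ki] := ltnP i k; first by rewrite /= ik.
  have [->|ne] := eqVneq i k; last first.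
    rewrite /=; have -> : (i.+1 < k) = false by lia.
    have -> : (i.+1 == k) = false by lia.
    by have -> : (i.+1 == k.+1) = false by lia.
  rewrite /=; have -> : (k + odd s < k) = false by lia.
  case: (boolP (odd s)) => os.
    by rewrite addn1 gtn_eqF ?ltnSn // eqxx; congr (_, _); lia.
  by rewrite addn0 eqxx; congr (_, _); lia.
Qed.

Lemma act_swap i j p : i < j ->
  act [:: (j, false); (i, false)] p = act [:: (i, false); (j.+1, false)] p.
Proof.
move=> ij; case: p => [k s]; rewrite /act /=.
have [kj|jk] := ltnP k j; rewrite /=.
  have [ki|ik] := ltnP k i; rewrite /=; first by have -> : k < j.+1 by lia.
  have [_|ne] := eqVneq k i; rewrite /=; first by have -> : i + odd s < j.+1 by lia.
  by have -> : k.+1 < j.+1 by lia.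
have -> : (k < i) = false by lia.
have -> : (k == i) = false by lia.
rewrite /= ltnS [k < j]ltnNge jk /= eqSS.
have [_|ne] := eqVneq k j; rewrite /=; last first.
  have -> : (k.+1 < i) = false by lia.
  by have -> : (k.+1 == i) = false by lia.
have -> : (j + odd s < i) = false by lia.
by have -> : (j + odd s == i) = false by lia.
Qed.

Lemma act_Feq u v : Feq u v -> forall p, act u p = act v p.
Proof.
elim=> {u v} //.
- by move=> u v w _ IH1 _ IH2 p; rewrite IH1 IH2.
- by move=> u u' v v' _ IH1 _ IH2 p; rewrite !act_cat IH1 IH2.
- exact: act_cancel.
move=> i j ij p; rewrite -[[:: _; _; _]]/([:: (i, true)] ++ [:: (j, false); (i, false)]).
rewrite act_cat act_swap // -act_cat.
rewrite -[[:: _] ++ _]/([:: (i, true); linv (i, true)] ++ [:: (j.+1, false)]).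
by rewrite act_cat act_cancel.
Qed.

Definition Fapply (g : F) p := act (Frepr g) p.

Lemma Fapply_class w p : Fapply (Fclass w) p = act w p.
Proof. exact: act_Feq (Frepr_class w) p. Qed.

Lemma FapplyM g h p : Fapply (g * h) p = Fapply h (Fapply g p).
Proof. by rewrite -(FclassK g) -(FclassK h) FclassM !Fapply_class act_cat. Qed.

(** The subgroup generated by x_j, x_(j+1), ... *)
Definition above j (g : F) := exists2 w : word, all (fun l => j <= l.1) w & g = Fclass w.

Lemma above1 j : above j 1.
Proof. by exists [::]. Qed.

Lemma aboveM j g h : above j g -> above j h -> above j (g * h).
Proof.
by move=> [u ju ->] [v jv ->]; exists (u ++ v); rewrite ?all_cat ?ju // FclassM.
Qed.

Lemma aboveV j g : above j g -> above j g^-1.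
Proof.
case=> w jw ->; exists (winv w); first by rewrite /winv all_rev all_map.
by apply: mulg1_eq; rewrite FclassM; apply/FclassP/Feq_winvr.
Qed.

Lemma above_x j k : j <= k -> above j (x_ k).
Proof. by move=> jk; exists [:: (k, false)]; rewrite //= jk. Qed.

Lemma aboveX j g n : above j g -> above j (g ^+ n).
Proof. by move=> jg; elim: n => [|n IH]; [apply: above1 | rewrite expgS;
  apply: aboveM]. Qed.

Lemma above_le j j' g : j <= j' -> above j' g -> above j g.
Proof. by move=> jj' [w jw ->]; exists w => //; apply: sub_all jw => l /=;
  apply: leq_trans. Qed.

(** Conjugation by x_i is the shift of generators on the subgroup above i. *)
Lemma above_conj i j g : i < j -> above j g -> above j.+1 (g ^ x_ i).
Proof.
move=> ij [w jw ->]; elim: w jw => [|l w IH] /=.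
  by rewrite Fclass_nil conj1g => _; apply: above1.
case/andP=> jl /IH {}IH; rewrite -cat1s -FclassM conjMg; apply: aboveM IH.
have xl : x_ l.1 ^ x_ i = x_ l.1.+1 by rewrite conjgE x_swap ?mulKg //; apply: leq_trans jl.
case: l jl xl => k [] /= jk xl; last by rewrite -/(x_ k) xl; apply: above_x.
by rewrite -x_V conjVg xl; apply/aboveV/above_x.
Qed.

Lemma above_conjX i j g c : i < j -> above j g -> above (j + c) (g ^ (x_ i ^+ c)).
Proof.
move=> ij; elim: c => [|c IH] jg; first by rewrite conjg1 addn0.
by rewrite expgSr conjgM addnS; apply: above_conj; [lia | apply: IH].
Qed.

(** Letters of index above i do not see the tree i. *)
Lemma Fapply_above j g i s : above j g -> i < j -> Fapply g (i, s) = (i, s).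
Proof.
case=> w jw -> ij; rewrite Fapply_class; elim: w jw => //= l w IH /andP [jl /IH].
by case: l jl => k e /= jk; rewrite /act /= (leq_trans ij jk).
Qed.

Lemma Fapply_x i M e : Fapply (x_ i ^+ e) (i, (2 ^ (M + e))%N) = (i, (2 ^ M)%N).
Proof.
elim: e => [|e IH]; first by rewrite expg0 -Fclass_nil Fapply_class addn0.
rewrite expgS FapplyM Fapply_class /act /= ltnn eqxx addnS expnS mul2n odd_double doubleK addn0.
exact: IH.
Qed.

Lemma Fapply_xV i M e : Fapply ((x_ i ^+ e)^-1) (i, (2 ^ M)%N) = (i, (2 ^ (M + e))%N).
Proof. by rewrite -(Fapply_x i M e) -FapplyM mulgV -Fclass_nil Fapply_class. Qed.

(** Follow the point (i, 2^M) for a large M: y fixes the tree i pointwise, so that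
    only the powers of x_i change the exponent of 2. *)
Lemma exponent_balance (i b a b' a' : nat) y y' : above i.+1 y -> above i.+1 y' ->
  x_ i ^+ b * y * (x_ i ^+ a)^-1 = x_ i ^+ b' * y' * (x_ i ^+ a')^-1 -> b + a' = b' + a.
Proof.
move=> iy iy' e; have := congr1 (fun g => Fapply g (i, (2 ^ (b + b'))%N)) e.
rewrite !FapplyM Fapply_x addnC Fapply_x !(Fapply_above _ iy) ?(Fapply_above _ iy') //
  !Fapply_xV.
by case=> /(congr1 (logn 2)); rewrite !pfactorK //; lia.
Qed.

Lemma above_forest_word a i n : above i (forest_word a i n).
Proof.
elim: n i => [|n IH] i; first by rewrite forest_word0; apply: above1.
rewrite forest_word_cons; apply: aboveM; first exact/aboveX/above_x.
exact: above_le (IH _).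
Qed.

Definition normal_form a b i n := forest_word b i n * (forest_word a i n)^-1.

Lemma normal_form_cons a b i n : normal_form a b i n.+1 =
  x_ i ^+ b i * normal_form a b i.+1 n * (x_ i ^+ a i)^-1.
Proof. by rewrite /normal_form !forest_word_cons invgM !mulgA. Qed.

Lemma above_normal_form a b i n : above i (normal_form a b i n).
Proof. by apply: aboveM; [|apply: aboveV]; apply: above_forest_word. Qed.

(** By [exponent_balance] the two exponents of x_i are equal.  If they were
    positive, conjugation by this power of x_i would show that the inner part lies
    above i+2; by induction its exponents at i+1 vanish, against reducedness. *)
Lemma normal_form_head a b i n : reduced a b -> vanish_from a (i + n) ->
  vanish_from b (i + n) ->
  above i.+1 (normal_form a b i n) -> a i = 0 /\ b i = 0.
Proof.
move=> red; elim: n i => [|n IH] i aN bN; first by rewrite aN ?bN; lia.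
rewrite normal_form_cons => iy; have := above_normal_form a b i.+1 n;
  set y := normal_form _ _ _ _ => iy1.
have := @exponent_balance i (b i) (a i) 0 0 y _ iy1 iy.
rewrite expg0 mul1g invg1 mulg1 addn0 add0n => /(_ erefl) ab.
have [//|b0] := posnP (b i); first by lia.
have : above i.+2 y.
  have -> : y = (x_ i ^+ b i * y * (x_ i ^+ a i)^-1) ^ (x_ i ^+ b i).
    by rewrite conjgE ab mulgVK mulKg.
  by apply: above_le (above_conjX (b i) (ltnSn i) iy); lia.
rewrite -addSnnS in aN bN.
by case/(IH _ aN bN) => a1 b1; have := red i; rewrite a1 b1 -ab; lia.
Qed.

(** By [exponent_balance] the exponents of x_i on the two sides differ by the same
    amount c.  If c > 0, then the inner part of one form is the shift by c of the
    other one, so its exponents at i+1 vanish ([normal_form_head]) although those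
    at i are positive. *)
Lemma normal_form_inj a b a' b' i n : reduced a b -> reduced a' b' ->
  vanish_from a (i + n) -> vanish_from b (i + n) ->
  vanish_from a' (i + n) -> vanish_from b' (i + n) ->
  normal_form a b i n = normal_form a' b' i n -> forall j, i <= j -> a j = a' j /\ b j =
    b' j.
Proof.
move=> red red'; elim: n i => [|n IH] i aN bN a'N b'N.
  by move=> _ j ij; rewrite aN ?bN ?a'N ?b'N //; lia.
have key c c' d d' : reduced d d' -> vanish_from d (i.+1 + n) ->
  vanish_from d' (i.+1 + n) ->
    normal_form c c' i n.+1 = normal_form d d' i n.+1 -> c' i <= d' i -> c i = d i /\
      c' i = d' i.
  move=> redd dN d'N; rewrite !normal_form_cons => e le.
  have ce := exponent_balance (above_normal_form _ _ _ _) (above_normal_form _ _ _ _) e.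
  have [//|lt] : (c i = d i /\ c' i = d' i) \/ c' i < d' i by lia.
  have [] // : d i.+1 = 0 /\ d' i.+1 = 0; last first.
    by move=> d0 d'0; have := redd i; rewrite d0 d'0; lia.
  apply: normal_form_head redd dN d'N _.
  (* m is the excess of the exponents of x_i, common to both sides. *)
  pose m := d' i - c' i; pose y := x_ i ^+ m.
  have ed' : d' i = c' i + m by rewrite /m; lia.
  have ed : d i = c i + m by rewrite /m; lia.
  have ey : normal_form c c' i.+1 n = y * normal_form d d' i.+1 n * y^-1.
    apply: (@mulIg _ (x_ i ^+ c i)^-1); apply: (@mulgI _ (x_ i ^+ c' i)).
    by move: e; rewrite ed ed' !expgnDr invgM -/y !mulgA.
  have -> : normal_form d d' i.+1 n = normal_form c c' i.+1 n ^ y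
    by rewrite ey conjgE mulgVK mulKg.
  by apply: above_le (above_conjX m (ltnSn i) (above_normal_form _ _ _ _)); lia.
move=> e j; rewrite leq_eqVlt => /orP [/eqP <-|ij].
  have [le|lt] := leqP (b i) (b' i).
    by apply: key e le => //; rewrite addSnnS.
  by have [||-> ->] // := key _ _ _ _ red _ _ (esym e) (ltnW lt); rewrite addSnnS.
rewrite -addSnnS in aN bN a'N b'N; apply: (IH i.+1) => //.
have [ea eb] : a i = a' i /\ b i = b' i.
  have [le|lt] := leqP (b i) (b' i); first exact: key e le.
  by have [-> ->] := key _ _ _ _ red aN bN (esym e) (ltnW lt).
by move: e; rewrite !normal_form_cons ea eb => /mulIg /mulgI.
Qed.

Lemma represents_inj a b a' b' g m m' : reduced a b -> reduced a' b' ->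
  represents a b g m -> represents a' b' g m' -> a = a' /\ b = b'.
Proof.
move=> red red' r r'.
have [N hN] := represents_supp r; have [N' hN'] := represents_supp r'.
have [aM bM] := hN (N + N') (leq_addr _ _); have [a'M b'M] := hN' (N + N') (leq_addl _ _).
have [e _] := (representsP g m aM bM).1 r; have [e' _] := (representsP g m' a'M b'M).1 r'.
have inj := @normal_form_inj a b a' b' 0 (N + N') red red' aM bM a'M b'M.
by split; apply: funext => j; have [] := inj (etrans (esym e) e') j (leq0n j).
Qed.

End Uniqueness.

(** * Adjacency in a tree *)

Section Adjacency.

Implicit Types (t l r : tree) (a b u : address).

Lemma ncarets_node l r : ncarets (Node l r) = (ncarets l + ncarets r).+1.
Proof. by rewrite /ncarets /= size_cat /= !size_map addnS. Qed.

Lemma size_leaves t : size (leaves t) = (ncarets t).+1.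
Proof.
elim: t => //= l IHl r IHr.
by rewrite size_cat !size_map IHl IHr ncarets_node; lia.
Qed.

Lemma leaf_l l r k : k <= ncarets l -> leaf (Node l r) k = false :: leaf l k.
Proof.
move=> kl; rewrite /leaf /= nth_cat size_map size_leaves ltnS kl.
by rewrite (nth_map [::]) // size_leaves.
Qed.

Lemma leaf_r l r k : k <= ncarets r -> leaf (Node l r) ((ncarets l).+1 + k) =
  true :: leaf r k.
Proof.
move=> kr; rewrite /leaf /= nth_cat size_map size_leaves ltnNge leq_addr /= addKn.
by rewrite (nth_map [::]) // size_leaves.
Qed.

Lemma leaf_out t k : ncarets t < k -> leaf t k = [::].
Proof. by move=> tk; rewrite /leaf nth_default // size_leaves. Qed.

Lemma caret_l l r p : 0 < p <= ncarets l -> caret (Node l r) p = false :: caret l p.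
Proof.
move=> pl; rewrite /caret /= nth_cat size_map -/(ncarets l).
have -> : p.-1 < ncarets l by lia.
by rewrite (nth_map [::]) // -/(ncarets l); lia.
Qed.

Lemma caret_root l r : caret (Node l r) (ncarets l).+1 = [::].
Proof. by rewrite /caret /= nth_cat size_map ltnn subnn. Qed.

Lemma caret_r l r p : 0 < p <= ncarets r ->
  caret (Node l r) ((ncarets l).+1 + p) = true :: caret r p.
Proof.
move=> pr; rewrite /caret /= nth_cat size_map -/(ncarets l).
have -> : (ncarets l + p < ncarets l) = false by lia.
rewrite addKn; case: p pr => [|p] pr; first by lia.
by rewrite /= (nth_map [::]).
Qed.

Lemma caret_in t p : 0 < p <= ncarets t -> caret t p \in carets t.
Proof. move=> pt; have lt : p.-1 < ncarets t by lia. exact: mem_nth. Qed.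

Lemma caret_in_node l r p : 0 < p <= ncarets (Node l r) ->
  [\/ 0 < p <= ncarets l, p = (ncarets l).+1
    | exists2 p', p = (ncarets l).+1 + p' & 0 < p' <= ncarets r].
Proof.
rewrite ncarets_node => pt; have [pl|lp] := leqP p (ncarets l); first by apply: Or31; lia.
have [->|ne] := eqVneq p (ncarets l).+1; first exact: Or32.
by apply: Or33; exists (p - (ncarets l).+1); lia.
Qed.

Lemma leaf_in_node l r k : k <= ncarets (Node l r) ->
  k <= ncarets l \/ exists2 k', k = (ncarets l).+1 + k' & k' <= ncarets r.
Proof.
rewrite ncarets_node => kt; have [kl|lk] := leqP k (ncarets l); first by left.
by right; exists (k - (ncarets l).+1); lia.
Qed.

Lemma right_caretE a : right_caret a = all id a.
Proof.
by rewrite /right_caret /on_right_side /left_edge /right_edge !all_rcons.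
Qed.

Lemma left_caretE a : left_caret a = all negb a.
Proof. by rewrite /left_caret /on_left_side /left_edge /right_edge !all_rcons /= orbF. Qed.

(** Some vertex of [t] covers exactly the leaves p, ..., q-1, where the leaves of [t]
    are numbered from [o].  The root is included. *)
Fixpoint subtree_at t o p q : bool :=
  (p == o) && (q == o + (ncarets t).+1) ||
  (if t is Node l r then subtree_at l o p q || subtree_at r (o + (ncarets l).+1) p q else
    false).

Lemma subtree_at_bound t o p q : subtree_at t o p q ->
  [&& o <= p, p < q & q <= o + (ncarets t).+1].
Proof.
elim: t o => [|l IHl r IHr] o.
  by rewrite /subtree_at orbF; lia.
rewrite /= ncarets_node => /orP [|/orP [/IHl|/IHr]]; lia.
Qed.

Lemma subtree_at_full t o : subtree_at t o o (o + (ncarets t).+1).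
Proof. by case: t => [|l r]; rewrite /= !eqxx. Qed.

(** A vertex with leaves o, ..., o+q-1 lies on the left side, at the left end
    of caret q. *)
Lemma subtree_at_left t o q : 0 < q <= ncarets t -> subtree_at t o o (o + q) =
  all negb (caret t q).
Proof.
elim: t o q => [|l IHl r IHr] o q qt; first by rewrite /ncarets /= in qt; lia.
have -> : subtree_at (Node l r) o o (o + q) = subtree_at l o o (o + q).
  rewrite [LHS]/= ncarets_node; have -> : (o + q == o + (ncarets l + ncarets r).+2) = false.
    by rewrite ncarets_node in qt; lia.
  rewrite andbF /=; case e : (subtree_at r _ _ _); last by rewrite orbF.
  by have := subtree_at_bound e; lia.
case: (caret_in_node qt) => [ql|->|[q' -> q'r]].
- by rewrite caret_l //= IHl.
- by rewrite caret_root subtree_at_full.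
rewrite caret_r //=; apply/negP => /subtree_at_bound; lia.
Qed.

Lemma subtree_at_right t o p : 0 < p <= ncarets t ->
  subtree_at t o (o + p) (o + (ncarets t).+1) = all id (caret t p).
Proof.
elim: t o p => [|l IHl r IHr] o p pt; first by rewrite /ncarets /= in pt; lia.
have -> : subtree_at (Node l r) o (o + p) (o + (ncarets (Node l r)).+1) =
    subtree_at r (o + (ncarets l).+1) (o + p) (o + (ncarets l).+1 + (ncarets r).+1).
  rewrite [LHS]/=; have -> : (o + p == o) = false by lia.
  rewrite /= ncarets_node; have -> : o + (ncarets l + ncarets r).+2 =
    o + (ncarets l).+1 + (ncarets r).+1 by lia.
  by case e : (subtree_at l _ _ _) => //; have := subtree_at_bound e; lia.
case: (caret_in_node pt) => [pl|->|[p' -> p'r]].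
- by rewrite caret_l //=; apply/negP => /subtree_at_bound; lia.
- by rewrite caret_root subtree_at_full.
by rewrite caret_r //= addnA IHr.
Qed.

Lemma gen_leftP t a e : reflect
  (e = left_edge a \/ exists b, [/\ b \in carets t, on_left_spine a b & e = right_edge b])
  (e \in gen_left_edge t a).
Proof.
rewrite inE; apply: (iffP orP) => -[/eqP|]; try by left.
- by case/mapP => b; rewrite mem_filter => /andP [? ?] ->; right; exists b.
- by case=> b [bt sp ->]; right; apply: map_f; rewrite mem_filter sp.
Qed.

Lemma gen_rightP t a e : reflect
  (e = right_edge a \/ exists b, [/\ b \in carets t, on_right_spine a b & e = left_edge b])
  (e \in gen_right_edge t a).
Proof.
rewrite inE; apply: (iffP orP) => -[/eqP|]; try by left.
- by case/mapP => b; rewrite mem_filter => /andP [? ?] ->; right; exists b.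
- by case=> b [bt sp ->]; right; apply: map_f; rewrite mem_filter sp.
Qed.

Definition child (c : bool) l r := if c then r else l.

Lemma mem_carets_node l r b : (b \in carets (Node l r)) =
  if b is c :: b' then b' \in carets (child c l r) else true.
Proof.
rewrite /= mem_cat inE; case: b => [|c b] /=; first by rewrite orbT.
have inj (d : bool) : injective (cons d) by move=> x y [].
have no d (s : seq address) : d != c -> (c :: b \in map (cons d) s) = false.
  by move=> dc; apply/mapP => -[x _ [e _]]; rewrite e eqxx in dc.
by case: c no => no /=; rewrite (mem_map (@inj _)) no ?orbF.
Qed.

Lemma on_left_spine_cons (c d : bool) a b :
  on_left_spine (c :: a) (d :: b) = (c == d) && on_left_spine a b.
Proof. by rewrite /on_left_spine /= andbA; case: c d => [] []. Qed.

Lemma on_right_spine_cons (c d : bool) a b :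
  on_right_spine (c :: a) (d :: b) = (c == d) && on_right_spine a b.
Proof. by rewrite /on_right_spine /= andbA; case: c d => [] []. Qed.

Lemma gen_left_cons l r c a e : (e \in gen_left_edge (Node l r) (c :: a)) =
  if e is d :: e' then (c == d) && (e' \in gen_left_edge (child c l r) a) else false.
Proof.
apply/gen_leftP/idP => [[->|[b [bt sp ->]]]|].
- by rewrite /left_edge /= eqxx; apply/gen_leftP; left.
- rewrite mem_carets_node in bt; case: b bt sp => // d b bt.
  rewrite on_left_spine_cons => /andP [/eqP cd sp]; subst d.
  by rewrite /right_edge /= eqxx; apply/gen_leftP; right; exists b.
case: e => // d e /andP [/eqP <-] /gen_leftP [->|[b [bt sp ->]]]; first by left.
right; exists (c :: b); split=> //; first by rewrite mem_carets_node.
by rewrite on_left_spine_cons eqxx.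
Qed.

Lemma gen_right_cons l r c a e : (e \in gen_right_edge (Node l r) (c :: a)) =
  if e is d :: e' then (c == d) && (e' \in gen_right_edge (child c l r) a) else false.
Proof.
apply/gen_rightP/idP => [[->|[b [bt sp ->]]]|].
- by rewrite /right_edge /= eqxx; apply/gen_rightP; left.
- rewrite mem_carets_node in bt; case: b bt sp => // d b bt.
  rewrite on_right_spine_cons => /andP [/eqP cd sp]; subst d.
  by rewrite /left_edge /= eqxx; apply/gen_rightP; right; exists b.
case: e => // d e /andP [/eqP <-] /gen_rightP [->|[b [bt sp ->]]]; first by left.
right; exists (c :: b); split=> //; first by rewrite mem_carets_node.
by rewrite on_right_spine_cons eqxx.
Qed.

(** [adjacent] in terms of addresses. *)
Definition meets t a b := has (mem (gen_left_edge t b)) (gen_right_edge t a).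

Lemma meets_cons l r c a b :
  meets (Node l r) (c :: a) (c :: b) = meets (child c l r) a b.
Proof.
apply/hasP/hasP => -[e].
- rewrite gen_right_cons; case: e => // d e /andP [/eqP <- ea] /=.
  by rewrite gen_left_cons eqxx => eb; exists e.
- by move=> ea eb; exists (c :: e); rewrite /= ?gen_right_cons ?gen_left_cons ?eqxx.
Qed.

Lemma meets_lr l r a b : meets (Node l r) (false :: a) (true :: b) = false.
Proof.
apply/negP => /hasP [e]; rewrite gen_right_cons; case: e => // d e /andP [/eqP <- _].
by rewrite /= gen_left_cons.
Qed.

Lemma meets_root_r l r b : b \in carets r ->
  meets (Node l r) [::] (true :: b) = all negb b.
Proof.
move=> br; apply/hasP/idP => [[e]|bn].
- move=> /gen_rightP [->|[c [_ sp ->]]] /=; rewrite gen_left_cons /=.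
    by case/gen_leftP => [/(congr1 size)|[c [_ _ /(congr1 size)]]]; rewrite size_rcons.
  case: c sp => [//|[] c]; last by rewrite /on_right_spine.
  rewrite /on_right_spine /= drop0 prefix0s /= => cn /gen_leftP [/rcons_inj [<- //]|].
  by case=> d [_ _ /rcons_inj []].
- exists (true :: left_edge b); last by rewrite /= gen_left_cons /=; apply/gen_leftP; left.
  apply/gen_rightP; right; exists (true :: b); split=> //; first by rewrite mem_carets_node.
  by rewrite /on_right_spine /= prefix0s drop0.
Qed.

Lemma meets_l_root l r a : a \in carets l ->
  meets (Node l r) (false :: a) [::] = all id a.
Proof.
move=> al; apply/hasP/idP => [[e]|an].
- rewrite gen_right_cons; case: e => // d e /andP [/eqP <- ea]
    /= /gen_leftP [[ee]|[c [_ sp]]].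
    by move: ea; rewrite ee => /gen_rightP [/(congr1 size)|[c [_ _ /(congr1 size)]]];
      rewrite size_rcons.
  case: c sp => [//|[] c]; first by rewrite /on_left_spine.
  rewrite /on_left_spine /= drop0 prefix0s /= => cn [ee]; move: ea; rewrite ee.
  by case/gen_rightP => [/rcons_inj [<- //]|[d' [_ _ /rcons_inj []]]].
- exists (false :: right_edge a); first by rewrite gen_right_cons /=; apply/gen_rightP;
    left.
  apply/gen_leftP; right; exists (false :: a); split=> //; first by rewrite mem_carets_node.
  by rewrite /on_left_spine /= prefix0s drop0.
Qed.

(** The edges shared by the generalized edges of p and q are those that lead down
    to a vertex with leaves p, ..., q-1. *)
Lemma subtree_at_adj t o p q : 0 < p -> p < q -> q <= ncarets t ->
  subtree_at t o (o + p) (o + q) = adjacent t p q.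
Proof.
rewrite /adjacent -/(meets _ _ _).
elim: t o p q => [|l IHl r IHr] o p q p0 pq qt; first by rewrite /ncarets /= in qt; lia.
have e1 : subtree_at (Node l r) o (o + p) (o + q) =
    subtree_at l o (o + p) (o + q) || subtree_at r (o + (ncarets l).+1) (o + p) (o + q).
  by rewrite [LHS]/=; have -> : (o + p == o) = false by lia.
have nol : ncarets l < p -> subtree_at l o (o + p) (o + q) = false.
  by move=> lp; apply/negP => /subtree_at_bound; lia.
have nol2 : (ncarets l).+1 < q -> subtree_at l o (o + p) (o + q) = false.
  by move=> lp; apply/negP => /subtree_at_bound; lia.
have nor : p <= ncarets l -> subtree_at r (o + (ncarets l).+1) (o + p) (o + q) = false.
  by move=> lp; apply/negP => /subtree_at_bound; lia.
have pt : 0 < p <= ncarets (Node l r) by lia.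
have {}qt : 0 < q <= ncarets (Node l r) by lia.
rewrite e1; case: (caret_in_node pt) => [pl|ep|[p' ep p'r]].
- rewrite nor ?orbF; last lia.
  case: (caret_in_node qt) => [ql|->|[q' eq q'r]].
  + by rewrite !caret_l // meets_cons IHl //; lia.
  + by rewrite caret_l // caret_root meets_l_root ?caret_in // subtree_at_right.
  + by rewrite nol2 ?eq ?caret_r ?caret_l ?meets_lr //; lia.
- have [q' eq q'r] : exists2 q', q = (ncarets l).+1 + q' & 0 < q' <= ncarets r.
    by case: (caret_in_node qt) => [?|?|//]; lia.
  rewrite nol ?ep // eq caret_root caret_r // meets_root_r ?caret_in //=.
  by rewrite addnA subtree_at_left.
- have [q' eq q'r] : exists2 q', q = (ncarets l).+1 + q' & 0 < q' <= ncarets r.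
    by case: (caret_in_node qt) => [?|?|//]; lia.
  rewrite nol ?ep ?eq ?caret_r // ?meets_cons; try lia.
  by rewrite !addnA IHr //; lia.
Qed.

End Adjacency.

(** * Leaf exponents of a tree *)

Section Exponents.

Implicit Types (t l r : tree) (a b u : address).

(** [leaf_exponent] as a function of the address of the leaf. *)
Definition left_run a := \max_(m < (size a).+1 |
  all (fun i => exponent_edge (take (size a - i) a)) (iota 0 m)) m.

Lemma leaf_exponentE t k : leaf_exponent t k = left_run (leaf t k).
Proof. by []. Qed.

Lemma left_runP a d : d <= size a ->
  (forall i, i < d -> exponent_edge (take (size a - i) a)) ->
  ~~ exponent_edge (take (size a - d) a) -> left_run a = d.
Proof.
move=> da hd nd; apply/eqP; rewrite eqn_leq; apply/andP; split.
  apply/bigmax_leqP => m /allP hm; rewrite leqNgt; apply/negP => dm.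
  by move/negP: nd; apply; apply: hm; rewrite mem_iota.
rewrite /left_run -[X in X <= _]/(nat_of_ord (Ordinal (da : d < (size a).+1))).
apply: leq_bigmax_cond; apply/allP => i; rewrite mem_iota => /= id.
by apply: hd.
Qed.

Lemma left_run_ex a : exists d, [/\ d <= size a,
  forall i, i < d -> exponent_edge (take (size a - i) a)
  & ~~ exponent_edge (take (size a - d) a)].
Proof.
have ex : exists d, ~~ exponent_edge (take (size a - d) a).
  by exists (size a); rewrite subnn take0.
case: (ex_minnP ex) => d nd dmin; exists d; split=> //.
  by apply: dmin; rewrite subnn take0.
by move=> i; rewrite ltnNge; apply: contraNT => /dmin.
Qed.

Lemma left_run_true a : left_run (true :: a) = left_run a.
Proof.
have [d [da hd nd]] := left_run_ex a; rewrite (left_runP da hd nd).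
have e i : i <= size a -> exponent_edge (take (size (true :: a) - i) (true :: a)) =
    exponent_edge (take (size a - i) a).
  move=> ia; rewrite /= subSn //= /exponent_edge /on_right_side /=.
  by case: (take (size a - i) a).
by apply: left_runP; rewrite ?e //= ?leqW // => i id; rewrite e ?hd //; lia.
Qed.

(** The number of left edges at the lower end of a path, with no exception for
    the right side of the tree. *)
Definition trailing_lefts a := find id (rev a).

Lemma trailing_lefts_cons (c : bool) a : trailing_lefts (c :: a) =
  if all negb a then size a + ~~ c else trailing_lefts a.
Proof.
rewrite /trailing_lefts rev_cons -cats1 find_cat has_rev.
have -> : has id a = ~~ all negb a.
  by rewrite -has_predC; apply: eq_has => x; rewrite /= negbK.
by rewrite if_neg; case: ifP => // _; rewrite size_rev; case: c.
Qed.

Lemma trailing_lefts_size a : trailing_lefts a <= size a.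
Proof. by rewrite -size_rev find_size. Qed.

Lemma trailing_lefts_id a : all id a -> a != [::] -> trailing_lefts a = 0.
Proof.
case/lastP: a => // a c; rewrite all_rcons => /andP [-> _] _.
by rewrite /trailing_lefts rev_rcons.
Qed.

Lemma trailing_lefts_negb a : all negb a -> trailing_lefts a = size a.
Proof.
move=> an; rewrite /trailing_lefts hasNfind ?size_rev // has_rev.
by apply/hasPn => x; apply: (allP an).
Qed.

(** Once a path has left the right side through a left edge, that edge does not
    count for the exponent and all later left edges do. *)
Lemma left_run_false a : left_run (false :: a) = trailing_lefts a.
Proof.
have e i : i < size a -> exponent_edge (take (size (false :: a) - i) (false :: a)) =
    ~~ nth true (rev a) i.
  move=> ia; rewrite nth_rev //= subSn ?(ltnW ia) //=.
  have [m em] : exists m, size a - i = m.+1 by exists (size a - i).-1; lia.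
  have sz : size (take m.+1 a) = m.+1 by rewrite size_take; case: ifP; lia.
  rewrite em /exponent_edge /on_right_side /= sz /= -nth_last sz /= nth_take //.
  rewrite !andbT; have -> : size a - i.+1 = m by lia.
  by rewrite (set_nth_default true) //; lia.
apply: left_runP; first by rewrite /= (leq_trans (trailing_lefts_size a)).
  move=> i it; rewrite e; last by apply: leq_trans it (trailing_lefts_size a).
  rewrite (set_nth_default false) ?size_rev ?(leq_trans it (trailing_lefts_size a)) //.
  by have /= -> := before_find false it.
have := trailing_lefts_size a; rewrite leq_eqVlt => /orP [/eqP ->|lt].
  by rewrite /= subSn // subnn /= take0.
by rewrite e // negbK; apply: (@nth_find _ true id); rewrite has_find size_rev.
Qed.

Lemma left_run_nil : left_run [::] = 0.
Proof. by apply: left_runP. Qed.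

(** Leaf exponents when no part of [t] belongs to the right side of the surrounding
    tree, so that every left edge counts. *)
Fixpoint texp t : seq nat :=
  if t is Node l r then incr_nth (texp l) 0 ++ texp r else [:: 0].

(** Leaf exponents of a whole tree: the left subtrees along its right side are
    strung together, followed by the last leaf. *)
Fixpoint sexp t : seq nat := if t is Node l r then texp l ++ sexp r else [:: 0].

Lemma size_texp t : size (texp t) = (ncarets t).+1.
Proof.
elim: t => //= l IHl r IHr; rewrite size_cat size_incr_nth IHl IHr ncarets_node /=; lia.
Qed.

Lemma size_sexp t : size (sexp t) = (ncarets t).+1.
Proof.
elim: t => //= l _ r IHr; rewrite size_cat size_texp IHr ncarets_node /=; lia.
Qed.

Lemma leaf0_negb t : all negb (leaf t 0).
Proof. by elim: t => // l IHl r _; rewrite leaf_l. Qed.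

Lemma leaf_negb t k : 0 < k <= ncarets t -> all negb (leaf t k) = false.
Proof.
elim: t k => [|l IHl r IHr] k kt; first by rewrite /ncarets /= in kt; lia.
have [kl|[k' -> kr]] := @leaf_in_node l r k (proj2 (andP kt)).
  by rewrite leaf_l //= IHl //; lia.
by rewrite leaf_r.
Qed.

Lemma leaf_last t : all id (leaf t (ncarets t)).
Proof.
elim: t => // l _ r IHr; rewrite ncarets_node -addSn leaf_r //.
Qed.

Lemma texpE t k : k <= ncarets t -> nth 0 (texp t) k = trailing_lefts (leaf t k).
Proof.
elim: t k => [|l IHl r IHr] k kt; first by rewrite /ncarets /= in kt; case: k kt.
rewrite [texp _]/=; have [kl|[k' -> kr]] := leaf_in_node kt.
  rewrite nth_cat size_incr_nth size_texp /= ltnS kl nth_incr_nth leaf_l //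
    trailing_lefts_cons IHl //.
  case: k kl {kt} => [|k] kl; first
    by rewrite leaf0_negb eqxx trailing_lefts_negb ?leaf0_negb //; lia.
  by rewrite leaf_negb.
rewrite nth_cat size_incr_nth size_texp /= ltnNge leq_addr /= addKn leaf_r //
  trailing_lefts_cons IHr //.
by case: ifP => // an; rewrite trailing_lefts_negb // addn0.
Qed.

Lemma sexpE t k : nth 0 (sexp t) k = leaf_exponent t k.
Proof.
rewrite leaf_exponentE; have [kt|tk] := leqP k (ncarets t); last first.
  by rewrite leaf_out // left_run_nil nth_default // size_sexp.
elim: t k kt => [|l _ r IHr] k kt; first by case: k kt => // _; rewrite -[leaf _ _]/[::]
  left_run_nil.
rewrite [sexp _]/= nth_cat size_texp; have [kl|[k' -> kr]] := leaf_in_node kt.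
  by rewrite ltnS kl leaf_l // left_run_false texpE.
by rewrite ltnNge leq_addr /= addKn leaf_r // left_run_true IHr.
Qed.

(** Only the exponent of the first leaf depends on the surroundings of [t], which is why
    the vertices that begin at o are described by visibility alone: the
    bound on the height of their end depends on [E o].  The four parts are
    proved together, since each of them for [Node l r] needs the height of the
    leaf in the middle. *)
Lemma tree_span t o (E : nat -> nat) :
  (forall i, 0 < i <= ncarets t -> E (o + i) = nth 0 (texp t) i) ->
  [/\ psum E (o + (ncarets t).+1) + nth 0 (texp t) 0 = psum E o.+1 + ncarets t,
     forall x, o < x < o + (ncarets t).+1 ->
       x + psum E (o + (ncarets t).+1) < o + (ncarets t).+1 + psum E x,
     forall p q, o < p -> p < q -> q <= o + (ncarets t).+1 -> span E p q <->
       subtree_at t o p q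
   & forall q, o < q <= o + (ncarets t).+1 ->
       (forall x, o < x < q -> x + psum E q < q + psum E x) <-> subtree_at t o o q].
Proof.
elim: t o => [|l IHl r IHr] o hE.
  change (ncarets Leaf) with 0; rewrite addn1; split=> //.
  - by move=> x; lia.
  - by move=> p q *; exfalso; lia.
  - move=> q oq; have -> : q = o.+1 by lia.
    by have := subtree_at_full Leaf o; rewrite addn1 => ->; split=> // _ x; lia.
have szl : size (incr_nth (texp l) 0) = (ncarets l).+1 by rewrite size_incr_nth size_texp.
have hl i : 0 < i <= ncarets l -> E (o + i) = nth 0 (texp l) i.
  move=> il; rewrite hE ?ncarets_node; last lia.
  rewrite [texp _]/= nth_cat szl nth_incr_nth.
  have -> : i < (ncarets l).+1 by lia.
  by have -> : (0 == i) = false by lia.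
have hr i : i <= ncarets r -> E (o + (ncarets l).+1 + i) = nth 0 (texp r) i.
  move=> ir; rewrite -addnA hE ?ncarets_node; last lia.
  by rewrite [texp _]/= nth_cat szl ltnNge leq_addr /= addKn.
have [pl vl sl el] := IHl o hl.
have [pr vr sr er] := IHr (o + (ncarets l).+1) (fun i hi => hr i (proj2 (andP hi))).
have hd : nth 0 (texp (Node l r)) 0 = (nth 0 (texp l) 0).+1.
  by rewrite [texp _]/= nth_cat szl nth_incr_nth.
have em := hr 0 (leq0n _); rewrite addn0 in em.
have eS : o + (ncarets (Node l r)).+1 = o + (ncarets l).+1 + (ncarets r).+1.
  by rewrite ncarets_node; lia.
rewrite hd eS; set mid := o + (ncarets l).+1 in hr pl vl sl el pr vr sr er em eS *.
set S := mid + (ncarets r).+1 in pr vr sr er eS *.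
have pm := psumS E mid; rewrite em in pm.
have om : o < mid by rewrite /mid; lia.
have mS : mid < S by rewrite /S; lia.
have hS : S + psum E mid = mid + 1 + psum E S by rewrite /S in pr *; lia.
have visS x : o < x < S -> x + psum E S < S + psum E x.
  move=> /andP [ox xS]; case: (ltngtP x mid) => [xm|mx|->]; last lia.
    by have := vl x; rewrite ox xm => /(_ isT); lia.
  by have := vr x; rewrite mx xS => /(_ isT); lia.
have nodeE p q : subtree_at (Node l r) o p q =
    (p == o) && (q == S) || (subtree_at l o p q || subtree_at r mid p q)
      by rewrite /= -/mid eS.
have nol p q : mid <= p \/ mid < q -> subtree_at l o p q = false.
  by move=> h; apply/negP => /subtree_at_bound; rewrite -/mid; lia.
have nor p q : p < mid -> subtree_at r mid p q = false.
  by move=> h; apply/negP => /subtree_at_bound; lia.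
split=> //.
- by rewrite ncarets_node; rewrite /S in pr hS *; lia.
- move=> p q op pq qS; rewrite nodeE; have -> : (p == o) = false by lia.
  rewrite /=; have [pm'|mp] := ltnP p mid.
    have [qm|mq] := leqP q mid; first by rewrite nor // orbF; apply: sl.
    rewrite nol ?nor; try lia; split=> // -[_ h vis].
    by have := vis mid; have := vl p; lia.
  rewrite nol /=; last lia.
  have [pe|ne] := eqVneq p mid; last by apply: sr => //; lia.
  subst p; rewrite -er; last by rewrite pq.
  split=> [[_ _ //]|vis]; split=> //.
  case: (ltngtP q S) qS => // [qS _|-> _]; last by lia.
  by have := visS q; lia.
- move=> q /andP [oq qS]; rewrite nodeE eqxx nor // orbF /=.
  have [qm|mq] := leqP q mid.
    have -> : (q == S) = false by lia.
    by apply: el; rewrite oq.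
  rewrite nol ?orbF; last by right.
  split=> [vis|/eqP ->]; last exact: visS.
  case: (ltngtP q S) qS => // lt _.
  have := vis mid; have := visS q; have := visS mid; lia.
Qed.

(** Along the right side the heights at the left subtrees are successive records,
    so that the records are the right carets and the remaining vertices are spans
    of the left subtrees. *)
Lemma spine_span t o (E : nat -> nat) :
  (forall i, i <= ncarets t -> E (o + i) = nth 0 (sexp t) i) ->
  (forall x, x < o -> x + psum E o < o + psum E x) ->
  [/\ psum E (o + (ncarets t).+1) = psum E o + non_right_carets t,
     forall p q, o <= p -> p < q -> q <= o + ncarets t -> span E p q <-> subtree_at t o p q
   & forall p, o < p <= o + ncarets t ->
       (forall x, x < p -> x + psum E p < p + psum E x) <->
         subtree_at t o p (o + (ncarets t).+1)].
Proof.
elim: t o => [|l _ r IHr] o hE ho.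
  change (ncarets Leaf) with 0; split=> [|p q *|p *]; try (by exfalso; lia).
  by rewrite addn1 psumS -[o in E o]addn0 hE.
have hl i : i <= ncarets l -> E (o + i) = nth 0 (texp l) i.
  move=> il; rewrite hE ?ncarets_node; last lia.
  by rewrite [sexp _]/= nth_cat size_texp ltnS il.
have hr i : i <= ncarets r -> E (o + (ncarets l).+1 + i) = nth 0 (sexp r) i.
  move=> ir; rewrite -addnA hE ?ncarets_node; last lia.
  by rewrite [sexp _]/= nth_cat size_texp ltnNge leq_addr /= addKn.
have [pl vl sl el] := tree_span (fun i hi => hl i (proj2 (andP hi))).
have eo := hl 0 (leq0n _); rewrite addn0 in eo.
have po := psumS E o; rewrite eo in po.
have eS : o + (ncarets (Node l r)).+1 = o + (ncarets l).+1 + (ncarets r).+1.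
  by rewrite ncarets_node; lia.
have eN : o + ncarets (Node l r) = o + (ncarets l).+1 + ncarets r.
  by rewrite ncarets_node; lia.
rewrite eS eN; set mid := o + (ncarets l).+1 in hr pl vl sl el eS *.
have om : o < mid by rewrite /mid; lia.
have hm : mid + psum E o = o + 1 + psum E mid by rewrite /mid in pl *; lia.
have rm x : x < mid -> x + psum E mid < mid + psum E x.
  move=> xm; case: (ltngtP x o) => [xo|ox|->]; last lia.
    by have := ho x xo; lia.
  by have := vl x; rewrite ox xm => /(_ isT).
have [pr sr er] := IHr mid hr rm.
have nodeE p q : subtree_at (Node l r) o p q =
    (p == o) && (q == mid + (ncarets r).+1) || (subtree_at l o p q || subtree_at r mid p q).
  by rewrite /= -/mid eS.
have nol p q : mid <= p \/ mid < q -> subtree_at l o p q = false.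
  by move=> h; apply/negP => /subtree_at_bound; rewrite -/mid; lia.
have nor p q : p < mid -> subtree_at r mid p q = false.
  by move=> h; apply/negP => /subtree_at_bound; lia.
split.
- rewrite pr; have -> : non_right_carets (Node l r) = ncarets l + non_right_carets r.
    rewrite /non_right_carets /= count_cat /= add0n !count_map.
    congr (_ + _).
  by rewrite addnA; congr (_ + _); lia.
- move=> p q op pq qN; rewrite nodeE.
  have -> : (q == mid + (ncarets r).+1) = false by lia.
  rewrite andbF /=; have [pm|mp] := ltnP p mid; last by rewrite nol; [apply: sr | left].
  rewrite nor // orbF; have [qm|mq] := leqP q mid; last first.
    rewrite nol; last by right.
    by split=> // -[_ h vis]; have := vis mid; have := rm p pm; lia.
  have [po'|ne] := eqVneq p o; last by apply: sl => //; lia.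
  subst p; rewrite -el; last by rewrite pq.
  split=> [[_ _ //]|vis]; split=> //.
  case: (ltngtP q mid) qm => // [lt _|-> _]; last lia.
  by have := vl q; lia.
- move=> p /andP [op pN]; rewrite nodeE; have -> : (p == o) = false by lia.
  rewrite nol /=; last by right; lia.
  case: (ltngtP p mid) => [lt|gt|->].
  + rewrite nor //; split=> // vis; have := vis o op; have := vl p; lia.
  + by apply: er; rewrite gt.
  + by rewrite subtree_at_full; split=> // _; apply: rm.
Qed.

End Exponents.

(** * Carets read off from leaf exponents *)

Section CaretTypes.

Implicit Types (t l r : tree) (a b u : address).

Lemma left_run_id a : all id a -> left_run a = 0.
Proof. by elim: a => [|[] a IH] //= ai; rewrite ?left_run_nil // left_run_true IH. Qed.

Lemma vanish_leaf_exponent t : vanish_from (leaf_exponent t) (ncarets t).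
Proof.
move=> i; rewrite leaf_exponentE leq_eqVlt => /orP [/eqP <-|ti].
  by rewrite left_run_id // leaf_last.
by rewrite leaf_out // left_run_nil.
Qed.

Lemma leaf_exponent_spans t : [/\ psum (leaf_exponent t) (ncarets t).+1 =
  non_right_carets t,
     forall p q, p < q -> q <= (ncarets t) -> span (leaf_exponent t) p q <->
       subtree_at t 0 p q
   & forall p, 0 < p <= (ncarets t) ->
       (forall x, x < p -> x + psum (leaf_exponent t) p < p + psum (leaf_exponent t) x) <->
       subtree_at t 0 p (ncarets t).+1].
Proof.
have h i : i <= ncarets t -> leaf_exponent t (0 + i) = nth 0 (sexp t) i by rewrite sexpE.
have [//|e1 e2 e3] := spine_span h.
by rewrite !add0n psum0 in e1 e2 e3; split=> // p q pq qN; apply: e2.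
Qed.

Lemma non_right_caretsE t : non_right_carets t = psum (leaf_exponent t) (ncarets t).
Proof.
have [<- _ _] := leaf_exponent_spans t;
  by rewrite psumS (vanish_leaf_exponent (leqnn (ncarets t))) addn0.
Qed.

Lemma adjacentE t p q : 0 < p -> p < q -> q <= (ncarets t) -> adjacent t p q <->
  span (leaf_exponent t) p q.
Proof.
by move=> p0 pq qN; have [_ h _] := leaf_exponent_spans t; rewrite h //
  -(subtree_at_adj 0) //.
Qed.

Lemma left_caret_span t q : 0 < q <= (ncarets t) -> left_caret (caret t q) <->
  span (leaf_exponent t) 0 q.
Proof.
move=> qN; have [_ h _] := leaf_exponent_spans t; rewrite h; try lia.
by rewrite left_caretE -(subtree_at_left 0) // add0n.
Qed.

Lemma right_caret_root t p : 0 < p <= (ncarets t) ->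
  right_caret (caret t p) <-> (forall x, x < p ->
    x + psum (leaf_exponent t) p < p + psum (leaf_exponent t) x).
Proof.
move=> pN; have [_ _ h] := leaf_exponent_spans t; rewrite h //
  right_caretE -(subtree_at_right 0) //.
Qed.

Lemma trailing_lefts_id0 a : all id a -> trailing_lefts a = 0.
Proof. by case: a => // c a; move/trailing_lefts_id; apply. Qed.

(** The right end of caret p is not a leaf, since its right subtree contains
    caret p+1. *)
Definition next_below t p := prefix (right_edge (caret t p)) (caret t p.+1).

Lemma next_below_texp t p : 0 < p < ncarets t -> next_below t p = (0 < nth 0 (texp t) p).
Proof.
elim: t p => [|l IHl r IHr] p pt; first by rewrite /ncarets /= in pt; lia.
have pt1 : 0 < p <= ncarets (Node l r) by lia.
rewrite /next_below [texp _]/= nth_cat size_incr_nth size_texp /= nth_incr_nth ltnS.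
case: (caret_in_node pt1) => [pl|ep|[p' ep p'r]].
- have -> : p <= ncarets l by lia.
  have -> : (0 == p) = false by lia.
  have [plt|ple] : p < ncarets l \/ p = ncarets l by lia.
    rewrite add0n -IHl /next_below; last lia.
    rewrite !caret_l; try lia.
    by rewrite /right_edge /= ?eqxx.
  rewrite ple caret_root -ple caret_l //= add0n texpE ?ple ?trailing_lefts_id0 ?leaf_last //.
- subst p; have r0 : 0 < ncarets r by rewrite ncarets_node in pt; lia.
  rewrite caret_root -(addn1 (ncarets l).+1) caret_r // ltnn subnn /= prefix0s.
  case: r r0 {IHr pt pt1} => // r1 r2 _; rewrite texpE // leaf_l // trailing_lefts_negb //=.
  by rewrite leaf0_negb.
- have p'lt : 0 < p' < ncarets r by rewrite ncarets_node in pt; lia.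
  rewrite ep -addnS !caret_r; try lia.
  have -> : ((ncarets l).+1 + p' <= ncarets l) = false by lia.
  by rewrite addKn /right_edge /= ?eqxx -IHr.
Qed.

Lemma next_below_not_left t p : next_below t p -> all negb (caret t p.+1) = false.
Proof.
case/prefixP => s ->; rewrite /right_edge cat_rcons all_cat /= andbF //.
Qed.

(** Leaf p is the leftmost leaf of the right subtree of caret p, so this subtree is
    more than a leaf iff a left edge leads down to leaf p.  That this edge counts
    for the exponent is what interiority of caret p+1 says. *)
Lemma typeN_exponent t p : 0 < p -> typeN t p = (0 < leaf_exponent t p).
Proof.
move=> p0; rewrite -sexpE /typeN; have [pt|tp] := ltnP p (ncarets t); last first.
  by rewrite sexpE vanish_leaf_exponent.
rewrite /= -/(next_below t p) /interior_caret left_caretE right_caretE.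
elim: t p p0 pt => [//|l _ r IHr] p p0 pt.
have pt1 : 0 < p <= ncarets (Node l r) by lia.
rewrite [sexp _]/= nth_cat size_texp ltnS.
case: (caret_in_node pt1) => [pl|ep|[p' ep p'r]].
- have -> : p <= ncarets l by lia.
  have [plt|ple] : p < ncarets l \/ p = ncarets l by lia.
    rewrite -next_below_texp; last by rewrite p0.
    rewrite /next_below !caret_l /=; try lia.
    rewrite andbT ?eqxx; case e : (prefix _ _); last by rewrite andbF.
    by rewrite (next_below_not_left e).
  by rewrite ple caret_root /= texpE // trailing_lefts_id0 // leaf_last.
- subst p; have r0 : 0 < ncarets r by rewrite ncarets_node in pt; lia.
  rewrite ltnn subnn sexpE leaf_exponentE /next_below caret_root -(addn1 (ncarets l).+1).
  rewrite caret_r //= prefix0s andbT.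
  case: r r0 {IHr pt pt1} => // r1 r2 _; rewrite leaf_l //
    left_run_false trailing_lefts_negb ?leaf0_negb //.
  case: r1 => [|r11 r12]; first by rewrite -[1]/(ncarets Leaf).+1 caret_root.
  by rewrite caret_l ?leaf_l ?ncarets_node.
- have p'lt : 0 < p' < ncarets r by rewrite ncarets_node in pt; lia.
  rewrite ep -addnS.
  have -> : ((ncarets l).+1 + p' <= ncarets l) = false by lia.
  rewrite addKn -IHr; try lia.
  rewrite /next_below -addnS !caret_r; try lia.
  rewrite /= ?eqxx; case e : (prefix _ _); last by rewrite !andbF.
  by rewrite (next_below_not_left e).
Qed.

Lemma subtree_at_leaf t o k : k <= ncarets t -> subtree_at t o (o + k) (o + k).+1.
Proof.
elim: t o k => [|l IHl r IHr] o k kt.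
  have -> : k = 0 by rewrite /ncarets /= in kt; lia.
  by have := subtree_at_full Leaf o; rewrite addn0 addn1.
rewrite /=; have [kl|[k' -> kr]] := leaf_in_node kt; first by rewrite IHl ?orbT.
by rewrite addnA IHr ?orbT.
Qed.

Lemma exposedP t i : reflect
  (exists a, [/\ a \in carets t, left_edge a = leaf t i & right_edge a = leaf t i.+1])
  (exposed t i).
Proof.
apply: (iffP hasP) => [[a at' /andP [/eqP e1 /eqP e2]]|[a [at' e1 e2]]]; first by exists a.
by exists a; rewrite // e1 e2 !eqxx.
Qed.

Lemma exposed_cons (c : bool) l r i x y : leaf (Node l r) i = c :: x ->
  leaf (Node l r) i.+1 = c :: y ->
  exposed (Node l r) i <-> exists a, [/\ a \in carets (child c l r), left_edge a =
    x & right_edge a = y].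
Proof.
move=> e1 e2; split=> [/exposedP [a []]|[a [ac ex ey]]].
- rewrite e1 e2 mem_carets_node; case: a => [|d a] //.
    by move=> _ [<-].
  by move=> ac [ed ex] [_ ey]; exists a; split=> //; rewrite -ed.
- by apply/exposedP; exists (c :: a); rewrite mem_carets_node e1 e2 -ex -ey.
Qed.

Lemma leaf_size0 t k : k <= ncarets t -> leaf t k = [::] -> ncarets t = 0.
Proof.
case: t => // l r kt; have [kl|[k' -> kr]] := leaf_in_node kt; first by rewrite leaf_l.
by rewrite leaf_r.
Qed.

(** An exposed caret is a vertex with two leaves. *)
Lemma exposed_subtree_at t o i : i < ncarets t -> exposed t i <->
  subtree_at t o (o + i) (o + i).+2.
Proof.
elim: t o i => [//|l IHl r IHr] o i it.
have nodeE : subtree_at (Node l r) o (o + i) (o + i).+2 <->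
   [\/ i = 0 /\ ncarets l + ncarets r = 0, i < ncarets l /\
     subtree_at l o (o + i) (o + i).+2
     | (ncarets l).+1 <= i /\ subtree_at r (o + (ncarets l).+1) (o + i) (o + i).+2].
  rewrite /= ncarets_node; split.
    case/orP => [h|/orP [h|h]]; first by apply: Or31; lia.
      by apply: Or32; split=> //; have := subtree_at_bound h; lia.
    by apply: Or33; split=> //; have := subtree_at_bound h; lia.
  by case=> [[i0 z]|[_ ->]|[_ ->]]; rewrite ?orbT //; apply/orP; left; lia.
rewrite nodeE ncarets_node in it *; have [il|li] := ltnP i (ncarets l).
  rewrite (exposed_cons (leaf_l _ (ltnW il)) (leaf_l _ il)).
  have -> : (exists a, [/\ a \in carets (child false l r), left_edge a =
    leaf l i & right_edge a = leaf l i.+1]) <->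
    exposed l i by split=> /exposedP.
  by rewrite (IHl o) //; split=> [h|[[i0 z]|[]|[]]] //; [apply: Or32 | lia | lia].
have [ei|ne] := eqVneq i (ncarets l).
  subst i; have e1 := @leaf_l l r _ (leqnn (ncarets l)).
  have e2 := @leaf_r l r 0 (leq0n _); rewrite addn0 in e2.
  split=> [/exposedP [a [_]]|].
    rewrite e1 e2; case: a => [|c a] /=; last by case=> -> _ [].
    case=> /esym/(leaf_size0 (leqnn _)) l0 [/esym/(leaf_size0 (leq0n _)) r0].
    by apply: Or31; lia.
  case=> [[_ z]|[]|[]]; try lia; apply/exposedP; exists [::].
  rewrite mem_carets_node e1 e2.
  by case: (l) z => [|? ?]; rewrite ?ncarets_node //; case: (r) => [|? ?];
    rewrite ?ncarets_node //; lia.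
have [j ej] : exists j, i = (ncarets l).+1 + j by exists (i - (ncarets l).+1); lia.
have jr : j < ncarets r by lia.
have e2 := @leaf_r l r j.+1 jr; rewrite addnS -ej in e2.
have e1 := @leaf_r l r j (ltnW jr); rewrite -ej in e1.
rewrite (exposed_cons e1 e2).
have -> : (exists a, [/\ a \in carets (child true l r), left_edge a =
  leaf r j & right_edge a = leaf r j.+1]) <->
    exposed r j by split=> /exposedP.
rewrite (IHr (o + (ncarets l).+1)) // -addnA -ej.
split=> [h|]; first by apply: Or33; split=> //; lia.
by case=> [[i0 z]|[il _]|[_ h]] //; lia.
Qed.

Lemma leaf_exponent_root t p : 0 < p -> p = ncarets t ->
  forall x, x < p -> x + psum (leaf_exponent t) p < p + psum (leaf_exponent t) x.
Proof.
move=> p0 ep; have [_ _ h] := leaf_exponent_spans t.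
have pt : 0 < p <= ncarets t by rewrite ep leqnn andbT -ep.
apply/(h p pt); by have := subtree_at_leaf 0 (leqnn (ncarets t)); rewrite add0n -ep.
Qed.

(** The last caret is a right caret, so the exponent just before it is 0. *)
Lemma leaf_exponent_pred t : leaf_exponent t (ncarets t).-1 = 0.
Proof.
case e : (ncarets t) => [|m] /=; first by rewrite vanish_leaf_exponent ?e.
by have := @leaf_exponent_root t m.+1 isT (esym e) m (ltnSn m); rewrite psumS; lia.
Qed.

Lemma exposed_exponent t i : 0 < leaf_exponent t i -> leaf_exponent t i.+1 = 0 ->
  exposed t i.
Proof.
move=> ei ei1.
have it : i < (ncarets t).-1.
  rewrite ltnNge; apply/negP => h; move: ei.
  have [->|ne] := eqVneq i (ncarets t).-1; first by rewrite leaf_exponent_pred.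
  by rewrite vanish_leaf_exponent //; lia.
apply/(exposed_subtree_at 0); first lia.
have [_ h _] := leaf_exponent_spans t; have it2 : i.+2 <= ncarets t by lia.
rewrite add0n; apply/(h i i.+2 (ltnW (ltnSn i.+1)) it2).
split=> //; first by rewrite !psumS; lia.
move=> x xi; have -> : x = i.+1 by lia.
by rewrite !psumS; lia.
Qed.

Lemma exponent_exposed t i : i.+1 < ncarets t -> exposed t i ->
  0 < leaf_exponent t i /\ leaf_exponent t i.+1 = 0.
Proof.
move=> it /(exposed_subtree_at 0 (ltnW it)); rewrite add0n; have [_ h _] :=
  leaf_exponent_spans t.
by case/h => // _; rewrite !psumS => h1 /(_ i.+1); rewrite !psumS; lia.
Qed.

(** Beyond a right caret with no exponents left, the tree is a chain of right
    carets that ends in an exposed one. *)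
Lemma exposed_last t p : 0 < p < ncarets t -> right_caret (caret t p) ->
  (forall i, p <= i -> leaf_exponent t i = 0) -> exposed t (ncarets t).-1.
Proof.
move=> pt rc z.
have rp : root_at (leaf_exponent t) (p - psum (leaf_exponent t) p) p.
  by apply: visible_root; apply/(right_caret_root (t := t)) => //; lia.
have [e v] := root_at_add (m := (ncarets t).-1 - p) rp (fun i hi => z i (proj1 (andP hi))).
have epm : p + ((ncarets t).-1 - p) = (ncarets t).-1 by lia.
rewrite epm in e v.
apply/(exposed_subtree_at 0); first lia.
have [_ _ h] := leaf_exponent_spans t; rewrite add0n prednK; last lia.
have pt' : 0 < (ncarets t).-1 <= ncarets t by lia.
by apply/(h _ pt') => x /v; lia.
Qed.

(** Removing an exposed last caret does not change the exponents, since both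
    of its leaves have exponent 0. *)
Lemma drop_last_caret t o : 1 < ncarets t ->
  subtree_at t o (o + (ncarets t).-1) (o + (ncarets t).+1) ->
  exists2 t', ncarets t' = (ncarets t).-1 & forall i, nth 0 (sexp t') i = nth 0 (sexp t) i.
Proof.
elim: t o => [//|l _ r IHr] o; rewrite [subtree_at _ _ _ _]/= ncarets_node => t1.
have -> : (o + (ncarets l + ncarets r).+1.-1 == o) = false by lia.
rewrite /= => /orP [/subtree_at_bound|h]; first lia.
have [r0|r1] := posnP (ncarets r); first by have := subtree_at_bound h; lia.
have [r2|e1] : 1 < ncarets r \/ ncarets r = 1 by lia.
  have [|r' nr' er'] := IHr (o + (ncarets l).+1) r2.
    have <- : o + (ncarets l + ncarets r) = o + (ncarets l).+1 + (ncarets r).-1 by lia.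
    by have <- : o + (ncarets l + ncarets r).+2 = o + (ncarets l).+1 + (ncarets r).+1
      by lia.
  exists (Node l r'); first by rewrite ncarets_node nr'; lia.
  by move=> i; rewrite /= !nth_cat er'.
exists (Node l Leaf); first by rewrite ncarets_node e1 addn1 -[ncarets Leaf]/(0) addn0.
move=> i; rewrite /= !nth_cat; case: ifP => // _.
case: r {IHr h t1 r1} e1 => // r1 r2; rewrite ncarets_node => -[/eqP].
rewrite addn_eq0; case: r1 => [|? ?]; last by rewrite ncarets_node.
case: r2 => [|? ?]; last by rewrite ncarets_node.
by move=> _ /=; case: (i - _) => [|[|[|?]]].
Qed.

(** Grafting the trees of [g] one by one to the right of [t] adds one left edge above
    the first leaf for each of them. *)
Lemma texp_foldl (g : seq tree) t x s : texp t = x :: s ->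
  texp (foldl Node t g) = (x + size g) :: s ++ flatten (map texp g).
Proof.
elim: g t x s => [|t0 g IH] t x s et /=; first by rewrite addn0 cats0.
by rewrite (IH _ x.+1 (s ++ texp t0)) /= ?et // catA addSnnS.
Qed.

(** From right to left, a leaf of exponent e absorbs the e trees that follow it;
    the M trivial trees at the end guarantee that there are enough. *)
Lemma build_forest (s : seq nat) M : \sum_(e <- s) e <= M ->
  exists2 f : seq tree, flatten (map texp f) = s ++ nseq M 0
    & M <= size f + \sum_(e <- s) e.
Proof.
elim: s => [|e s IH].
  exists (nseq M Leaf); last by rewrite size_nseq leq_addr.
  by rewrite map_nseq /=; elim: (M) => //= m ->.
rewrite big_cons => le; have [|f ef szf] := IH; first lia.
exists (foldl Node Leaf (take e f) :: drop e f).
  rewrite /= (@texp_foldl _ Leaf 0 [::]) //= size_take_min -flatten_cat -map_cat.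
  rewrite cat_take_drop ef.
  by congr (_ :: _); lia.
by rewrite /= size_drop; lia.
Qed.

Lemma sexp_foldr (f : seq tree) : sexp (foldr Node Leaf f) = flatten (map texp f) ++ [:: 0].
Proof. by elim: f => //= t f ->; rewrite catA. Qed.

Lemma build_tree (a : nat -> nat) B N : vanish_from a B -> B + psum a B <= N ->
  exists2 t, ncarets t = N & leaf_exponent t = a.
Proof.
move=> aB BN; have [|f ef _] := @build_forest (mkseq a B) (N - B).
  by rewrite /mkseq big_map -[B in iota 0 B]subn0 big_mkord -/(psum a B); lia.
have es : sexp (foldr Node Leaf f) = mkseq a B ++ nseq (N - B).+1 0.
  by rewrite sexp_foldr ef -catA -[[:: 0]]/(nseq 1 0) -nseqD addn1.
exists (foldr Node Leaf f).
  have := size_sexp (foldr Node Leaf f); rewrite es size_cat size_mkseq size_nseq; lia.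
apply: funext => i; rewrite -sexpE es nth_cat size_mkseq; case: ltnP => iB.
  by rewrite nth_mkseq.
by rewrite nth_nseq if_same aB.
Qed.

End CaretTypes.

(** * Penalty trees *)

Lemma natminP (A : set nat) : (exists k, A k) ->
  A (natmin A) /\ forall m, A m -> natmin A <= m.
Proof.
case=> k Ak; have ex : exists k, `[< A k >] by exists k; apply/asboolP.
case: (ex_minnP ex) => m /asboolP Am mmin.
have [] // := @xgetPex _ 0 [set k | A k /\ forall m, A m -> k <= m]%classic.
by exists m; split=> // m' Am'; apply/mmin/asboolP.
Qed.

Notation negexp D := (leaf_exponent D.1) (only parsing).
Notation posexp D := (leaf_exponent D.2) (only parsing).

Lemma tree_pair_size D : is_tree_pair D ->
  [/\ 0 < size_pair D, ncarets D.1 = size_pair D & ncarets D.2 = size_pair D].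
Proof. by case/andP => N0 /eqP e; split. Qed.

(** The spans of the two exponent sequences are the penalty relation; those that begin
    at 0 account for the dummy caret. *)
Lemma precE D p q : is_tree_pair D -> p < q -> q <= size_pair D ->
  prec D p q <-> linked (negexp D) (posexp D) p q.
Proof.
move=> /tree_pair_size [N0 e1 e2] pq qN; rewrite /prec pq qN /=.
have [p0|p0] := posnP p; rewrite /linked.
  have h1 : left_caret (caret D.1 q) <-> span (negexp D) 0 q by apply: left_caret_span; lia.
  have h2 : left_caret (caret D.2 q) <-> span (posexp D) 0 q by apply: left_caret_span; lia.
  rewrite p0 /=.
  by split=> [/orP|] [/h1|/h2] h; [left|right|apply/orP; left|apply/orP; right].
have h1 : adjacent D.1 p q <-> span (negexp D) p q by apply: adjacentE; rewrite ?e1.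
have h2 : adjacent D.2 p q <-> span (posexp D) p q by apply: adjacentE; rewrite ?e2.
by split=> [/orP|] [/h1|/h2] h; [left|right|apply/orP; left|apply/orP; right].
Qed.

(** Type N carets, by [typeN_exponent]. *)
Definition starts D s := 0 < s /\ 0 < negexp D s + posexp D s.

Lemma starts_lt D s : is_tree_pair D -> starts D s -> s < size_pair D.
Proof.
move=> /tree_pair_size [N0 e1 e2] [s0 ps]; rewrite ltnNge; apply/negP => h.
by move: ps; rewrite !vanish_leaf_exponent ?e1 ?e2.
Qed.

Lemma starts_penalty D s : is_tree_pair D -> starts D s -> penalty_caret D s.
Proof.
move=> Dp ss; have sN := starts_lt Dp ss; case: ss => s0 ps.
rewrite /penalty_caret s0 (ltnW sN) /= !typeN_exponent //.
by move: ps; rewrite addn_gt0 => /orP [->|->]; rewrite ?orbT.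
Qed.

Section FromTree.
Variables (n : nat) (D : tree_pair) (P : digraph 'I_(size_pair D).+1).
Hypotheses (Dp : is_tree_pair D) (Pp : penalty_tree P).

Lemma edge_lt u v : edge P u v -> u < v.
Proof.
by have [_ h _ _] := Pp; move/h; rewrite /prec => /andP [/andP []].
Qed.

Lemma edge_linked u v : edge P u v -> linked (negexp D) (posexp D) u v.
Proof.
move=> uv; apply/precE; [done | exact: edge_lt | exact: leq_ord |].
by have [_ h _ _] := Pp; apply: h.
Qed.

Lemma leaf_below v : v \in vertices P -> exists l h, leaf_vertex P l /\ dist_is P v l h.
Proof.
move e: (size_pair D - v) => m; elim/ltn_ind: m v e => m IH v e vP.
have [lf|nl] := pselect (forall w, ~~ edge P v w).
  by exists v, 0; split=> //; exists [::].
have [w vw] : exists w, edge P v w.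
  by apply: contrapT => h; apply: nl => w; apply/negP => vw; apply: h; exists w.
have [[_ he _ _ _] _ _ _] := Pp; have [_ wP] := he _ _ vw.
have := edge_lt vw; have := leq_ord w => wN vltw.
have [|l [h [ll [s [ps ls ss]]]]] := IH (size_pair D - w) _ w erefl wP; first lia.
by exists l, h.+1; split=> //; exists (w :: s); rewrite /= vw ps ls ss.
Qed.

(** The carets to be paid for. *)
Definition weighted_seq := [seq val v | v <- enum [set v | `[< weighted P n ord0 v >]]].

Lemma size_weighted_seq : size weighted_seq = weight P n ord0.
Proof. by rewrite size_map -cardE. Qed.

(** Along a path of the tree the level stays 1 while the vertices are weighted.
    The first unweighted vertex after that is less than n - 1 steps above any leaf
    below it, and this bounds all further free steps down to that leaf. *)
Lemma level_on_path s v l h : path (edge P) ord0 s -> s != [::] -> last ord0 s = v ->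
  leaf_vertex P l -> dist_is P v l h ->
  exists2 e, level (linked (negexp D) (posexp D)) weighted_seq v e & e = 1 \/ e + h <= n.
Proof.
move=> ps sn ls ll; elim/last_ind: s v h ps sn ls => [//|s w IH] v h.
rewrite rcons_path last_rcons => /andP [ps uw] _ <- {v} wl.
have luw := edge_linked uw.
have [s0|sn] := eqVneq s [::].
  by exists 1; [apply: LevelS (Level0 _ _) _; rewrite s0 in luw | left].
have ul : dist_is P (last ord0 s) l h.+1.
  by case: wl => s' [ps' ls' <-]; exists (w :: s'); rewrite /= uw.
have [e le he] := IH _ _ ps sn erefl ul.
case: he => [e1|eh]; last by exists e.+1; [apply: LevelS le luw | right; lia].
(* The parent has level 1: either w is weighted, or its height is small. *)
have [nh|hn] := leqP (n - 1) h; last by exists 2; [rewrite e1 in le;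
  apply: LevelS le luw | right; lia].
exists 1; last by left.
rewrite e1 in le; apply: LevelW le luw _; apply: map_f; rewrite mem_enum inE; apply/asboolP.
have [[_ hv _ _ _] _ _ _] := Pp; have [_ wP] := hv _ _ uw.
split=> //; last by exists l, h.
exists (size (rcons s w)); last by rewrite size_rcons; case: (s) sn.
by exists (rcons s w); rewrite rcons_path ps uw last_rcons.
Qed.

Lemma sufficient_of_tree : 0 < n -> sufficient n (negexp D) (posexp D) weighted_seq.
Proof.
move=> n0 s s0 ps; have ss : starts D s by split.
have sN : s < (size_pair D).+1 by have := starts_lt Dp ss; lia.
have [[_ _ _ _ hc] _ hp _] := Pp.
have vP : Ordinal sN \in vertices P by apply: hp; apply: starts_penalty.
have [l [h [ll lh]]] := leaf_below vP.
have /connectP [c pc ec] := hc _ vP.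
have cn : c != [::].
  by apply/eqP => c0; move: ec; rewrite c0 => /(congr1 val) /=; lia.
have [e le he] := level_on_path pc cn (esym ec) ll lh.
by exists e => //; lia.
Qed.

End FromTree.

Section ToTree.
Variables (n : nat) (D : tree_pair) (W : seq nat).
Hypothesis Dp : is_tree_pair D.
Let a := negexp D.
Let b := posexp D.
Let N := size_pair D.

Variable par : nat -> nat.
Hypothesis par0 : par 0 = 0.
Hypothesis par_linked : forall p, 0 < p -> linked a b (par p) p.
Hypothesis par_step : forall p, 0 < p -> minstep a b W (par p) p.

(** The vertices on the cheapest chains to the type N carets; [par] is the step before
    on a cheapest chain, so that these chains form a tree. *)
Definition needed v := v = 0 \/ exists k s, starts D s /\ v = iter k par s.

Definition chosen_tree : digraph 'I_N.+1 :=
  Digraph [set v : 'I_N.+1 | `[< needed v >]]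
    (fun u v => (0 < v) && ((u : nat) == par v) && `[< needed v >]).

Lemma par_lt p : 0 < p -> par p < p.
Proof. by move/par_linked/linked_lt. Qed.

Lemma needed_par p : needed p -> needed (par p).
Proof.
case=> [->|[k [s [ss ->]]]]; first by left.
by right; exists k.+1, s.
Qed.

Lemma chosen_vertex (v : 'I_N.+1) : v \in vertices chosen_tree <-> needed v.
Proof. by rewrite inE; split=> /asboolP. Qed.

Lemma chosen_edge (u v : 'I_N.+1) :
  edge chosen_tree u v <-> [/\ 0 < v, (u : nat) = par v & needed v].
Proof.
split=> [/andP [/andP [v0 /eqP uv] /asboolP nv] //|[v0 uv nv]].
by apply/andP; split; [rewrite v0 uv eqxx | apply/asboolP].
Qed.

Lemma chosen_rooted : rooted_tree chosen_tree ord0.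
Proof.
have parN (v : 'I_N.+1) : 0 < v -> par v < N.+1.
  by move=> v0; apply: leq_trans (par_lt v0) _; apply: ltnW.
split.
- by apply/chosen_vertex; left.
- move=> u v /chosen_edge [v0 uv nv]; split; apply/chosen_vertex => //.
  by rewrite uv; apply: needed_par.
- by move=> u; apply/negP => /chosen_edge [].
- move=> v /chosen_vertex nv v0.
  have v0' : 0 < v by rewrite lt0n; apply: contra v0 => /eqP v0; apply/eqP/val_inj.
  exists (Ordinal (parN _ v0')); split=> [|u /chosen_edge [_ uv _]];
    first exact/chosen_edge.
  exact: val_inj.
move=> [v vN] /chosen_vertex /=; elim/ltn_ind: v vN => v IH vN nv.
have [v0|v0] := posnP v.
  by have -> : Ordinal vN = ord0 by apply: val_inj.
have pN := parN (Ordinal vN) v0.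
apply: connect_trans (IH _ (par_lt v0) pN (needed_par nv)) (connect1 _).
exact/chosen_edge.
Qed.

(** If no link crosses p, then the chain down from s cannot jump over it. *)
Lemma iter_par_root p s : (forall x y, linked a b x y -> x < p -> y <= p) -> p <= s ->
  exists k, iter k par s = p.
Proof.
move=> nocross; elim/ltn_ind: s => s IH ps.
have [->|ne] := eqVneq p s; first by exists 0.
have s0 : 0 < s by lia.
have ps' : p <= par s.
  by rewrite leqNgt; apply/negP => h; have := nocross _ _ (par_linked s0) h; lia.
have [k ek] := IH _ (par_lt s0) ps'.
by exists k.+1; rewrite iterSr.
Qed.

Hypothesis Dr : is_reduced D.

(** A caret p that is right in both trees has a type N caret beyond it, for otherwise
    both trees would end in an exposed last caret; the chain to that caret
    visits p. *)
Lemma penalty_needed p : penalty_caret D p -> needed p.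
Proof.
have [N0 e1 e2] := tree_pair_size Dp.
case/andP => pN; rewrite orbA => /orP [h|/and3P [r1 r2 pne]].
  have p0 : 0 < p by lia.
  rewrite !typeN_exponent // in h; right; exists 0, p; split=> //; split=> //.
  by rewrite addn_gt0.
have [s [ss ps]] : exists s, starts D s /\ p <= s.
  apply: contrapT => h.
  have z i : p <= i -> a i = 0 /\ b i = 0.
    move=> pi; suff : ~ 0 < a i + b i by lia.
    by move=> ab; apply: h; exists i; split=> //; split=> //; lia.
  have x1 : exposed D.1 (size_pair D).-1.
    by rewrite -e1; apply: exposed_last r1 _; [rewrite e1; lia | move=> i /z []].
  have x2 : exposed D.2 (size_pair D).-1.
    by rewrite -e2; apply: exposed_last r2 _; [rewrite e2; lia | move=> i /z []].
  move: Dr; rewrite /is_reduced => /orP [/eqP N1|/hasPn /(_ (size_pair D).-1)]; first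
    by lia.
  by rewrite mem_iota x1 x2; lia.
have pt1 : 0 < p <= ncarets D.1 by rewrite e1.
have pt2 : 0 < p <= ncarets D.2 by rewrite e2.
have R1 := visible_root ((right_caret_root pt1).1 r1).
have R2 := visible_root ((right_caret_root pt2).1 r2).
have [|k ek] := @iter_par_root p s _ ps; last by right; exists k, s.
by move=> x y [sp|sp]; [apply: span_over_root R1 sp | apply: span_over_root R2 sp].
Qed.

Lemma par_le p : par p <= p.
Proof. by have [->|/par_lt/ltnW //] := posnP p; rewrite par0. Qed.

Lemma iter_par_le k s : iter k par s <= s.
Proof. by elim: k => //= k IH; apply: leq_trans (par_le _) IH. Qed.

Lemma chosen_leaf l : leaf_vertex chosen_tree l -> l = ord0 \/ starts D l.
Proof.
case=> /chosen_vertex [l0|[k [s [ss el]]]] nl; first by left; apply: val_inj.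
case: k el => [|k] /= el; first by right; rewrite el.
have [w0|w0] := posnP (iter k par s).
  by left; apply: val_inj; rewrite /= el w0.
have wN : iter k par s < N.+1.
  by apply: leq_ltn_trans (iter_par_le _ _) _; have := starts_lt Dp ss; rewrite -/N; lia.
by have /negP [] := nl (Ordinal wN); apply/chosen_edge; split=> //; right; exists k, s.
Qed.

Lemma chosen_penalty_tree : penalty_tree chosen_tree.
Proof.
split.
- exact: chosen_rooted.
- move=> p q /chosen_edge [q0 pq _]; rewrite pq; apply/precE => //.
  + exact: par_lt.
  + by have := ltn_ord q; rewrite ltnS.
  + exact: par_linked.
- by move=> p /penalty_needed np; apply/chosen_vertex.
have [e|ne] := pselect (vertices chosen_tree = [set ord0]); [by left | right].
move=> l ll; have [l0|/starts_penalty] := chosen_leaf ll; last exact.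
case: ne; apply/setP => v; rewrite finset.in_set1; apply/idP/eqP => [vV|->]; last first.
  by have [] := chosen_rooted.
have [_ _ _ _ /(_ _ vV)/connectP [[|w c] /= pc ->//]] := chosen_rooted.
by case/andP: pc => lw _; case: ll => _ /(_ w)/negP; case; rewrite l0.
Qed.

(** From level 2 on every step is counted. *)
Lemma minlevel_path v s l : path (edge chosen_tree) v s -> last v s = l ->
  1 < minlevel a b W v -> minlevel a b W v + size s <= minlevel a b W l.
Proof.
elim: s v => [|w s IH] v /=; first by move=> _ <-; rewrite addn0.
case/andP=> /chosen_edge [w0 vw _] ps ls v1.
have [ew|[e _ _]] := par_step w0; last by move: e; rewrite -vw; lia.
rewrite -vw in ew.
by have := IH w ps ls; rewrite ew addSn addnS; apply; apply: ltnW.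
Qed.

Hypothesis gW : sufficient n a b W.

(** An unpaid vertex v of depth at least 2 has level at least 2, so a leaf
    n - 1 steps below it would have level above n. *)
Lemma weighted_paid v : weighted chosen_tree n ord0 v -> val v \in W.
Proof.
case=> vV [d [s [ps ls ss]] d2] [l [h [ll [s' [ps' ls' ss']] nh]]].
have [v1|v1] := leqP (minlevel a b W v) 1; last first.
  have lv := minlevel_path ps' ls' v1.
  have [l0|[l0 sl]] := chosen_leaf ll.
    have : minlevel a b W 0 <= 0 by apply/minlevel_le/Level0.
    by move: lv; rewrite l0 /=; lia.
  have [e en le] := gW l0 sl; have := minlevel_le le; lia.
case/lastP: s ps ls ss => [|s w]; first by move=> _ _ e; rewrite -e in d2.
rewrite rcons_path last_rcons size_rcons => /andP [ps uw] ew sd; subst w.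
move/chosen_edge: uw => [v0 uv _].
have u0 : 0 < par v.
  rewrite -uv lt0n; apply/eqP => u0; case/lastP: s ps uv u0 sd => [|s z]; first
    by move=> /= _ _ _ e; lia.
  by rewrite rcons_path last_rcons => /andP [_ /chosen_edge [z0 _ _]] _; lia.
have : 0 < minlevel a b W (par v).
  rewrite lt0n; apply/eqP => e; have := minlevelP a b W (par v).
  by rewrite e => /level_eq0; lia.
by case: (par_step v0) => [|[] //]; lia.
Qed.

Lemma chosen_weight : weight chosen_tree n ord0 <= size W.
Proof.
rewrite /weight cardE -(size_map val); apply: uniq_leq_size.
  by rewrite (map_inj_uniq val_inj) enum_uniq.
move=> x /mapP [v]; rewrite mem_enum inE => /asboolP wv ->; exact: weighted_paid.
Qed.

End ToTree.

Lemma tree_of_sufficient n D W : is_tree_pair D -> is_reduced D ->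
  sufficient n (negexp D) (posexp D) W ->
  exists2 P : digraph 'I_(size_pair D).+1, penalty_tree P & weight P n ord0 <= size W.
Proof.
move=> Dp Dr gW.
have ex p : exists r, (p = 0 -> r = 0) /\ (0 < p -> linked (negexp D) (posexp D) r p /\
  minstep (negexp D) (posexp D) W r p).
  have [->|p0] := posnP p; first by exists 0.
  have [r lr sr] := minlevel_pred (negexp D) (posexp D) W p0.
  by exists r; split=> // p00; rewrite p00 in p0.
have [par hpar] := boolp.choice ex.
have par0 : par 0 = 0 by apply: (hpar 0).1.
have pl p (p0 : 0 < p) := ((hpar p).2 p0).1.
have pst p (p0 : 0 < p) := ((hpar p).2 p0).2.
by exists (chosen_tree D par); [exact: chosen_penalty_tree | exact: chosen_weight].
Qed.

(** The minimum over penalty trees is a minimum over sufficient sets of payments. *)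
Lemma penalty_weightP n D : 0 < n -> is_tree_pair D -> is_reduced D ->
  (exists2 W, size W = penalty_weight_pair n D & sufficient n (negexp D) (posexp D) W) /\
  forall W, sufficient n (negexp D) (posexp D) W -> penalty_weight_pair n D <= size W.
Proof.
move=> n0 Dp Dr.
have ex : exists k, [set k | exists2 P : digraph 'I_(size_pair D).+1,
            penalty_tree P & weight P n ord0 = k]%classic k.
  have [|P Pp _] := @tree_of_sufficient n D (iota 0 (size_pair D)) Dp Dr.
    move=> s s0 ps; exists 1 => //.
    have : s < size_pair D by apply: starts_lt.
    elim: s s0 {ps} => // k IH _ kN; have [k0|k0] := posnP k.
      by rewrite k0; apply: LevelS (Level0 _ _) (linked_succ _ _ _).
    apply: LevelW (IH k0 (ltnW kN)) (linked_succ _ _ _) _.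
    by rewrite mem_iota.
  by exists (weight P n ord0), P.
have [[P Pp eP] hmin] := natminP ex; split.
  exists (weighted_seq n P); first by rewrite size_weighted_seq.
  exact: sufficient_of_tree.
move=> W gW; have [P' P'p le] := tree_of_sufficient Dp Dr gW.
by apply: leq_trans le; apply: hmin; exists P'.
Qed.

(** * Reduced diagrams and word length *)

Lemma representedE D : is_tree_pair D ->
  represents (leaf_exponent D.1) (leaf_exponent D.2) (represented D)
      (non_right_carets D.1 + non_right_carets D.2).
Proof.
move=> /tree_pair_size [_ e1 e2].
have v1 : vanish_from (leaf_exponent D.1) (size_pair D).
  by rewrite -e1; apply: vanish_leaf_exponent.
have v2 : vanish_from (leaf_exponent D.2) (size_pair D).
  by rewrite -e2; apply: vanish_leaf_exponent.
exists (size_pair D) => //; split; last by rewrite !non_right_caretsE e1 e2.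
rewrite /represented prodgV revK -!/(forest_word _ _ _).
by rewrite (forest_word_vanish v1 _ (leqnSn _)) ?(forest_word_vanish v2 _ (leqnSn _)).
Qed.

Lemma is_reduced_exponents D : is_tree_pair D -> is_reduced D ->
  reduced (leaf_exponent D.1) (leaf_exponent D.2).
Proof.
move=> /tree_pair_size [N0 e1 e2] red i ai bi.
have iN : i < size_pair D.
  by rewrite ltnNge; apply/negP => h; move: ai; rewrite vanish_leaf_exponent ?e1.
rewrite lt0n; apply/eqP => z; case/orP: red => [/eqP N1|/hasPn /(_ i)].
  have i0 : i = (ncarets D.1).-1 by lia.
  by move: ai; rewrite i0 leaf_exponent_pred.
by rewrite mem_iota /= add0n iN !exposed_exponent //; [move=> /(_ isT) | lia | lia].
Qed.

Lemma Fgen (g : F) : exists n s, gen_word n s /\ \big[*%g/1%g]_(y <- s) y = g.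
Proof.
rewrite -(FclassK g); elim: (Frepr g) => [|[k e] w [n [s [gs es]]]].
  by exists 0, [::]; split=> //; rewrite big_nil.
exists (n + k), ((if e then (x_ k)^-1 else x_ k)%g :: s); split.
  move=> y; rewrite inE => /orP [/eqP ->|/gs].
    by case: e; [right; rewrite invgK | left]; exists k => //=; apply: leq_addl.
  by case=> -[i /= ni ei]; [left|right]; exists i => //=;
    apply: leq_trans ni (leq_addr _ _).
rewrite big_cons es; case: e; first by rewrite x_V FclassM.
by rewrite /x_ FclassM.
Qed.

Lemma represents_exists (g : F) : exists a b m, represents a b g m /\ reduced a b.
Proof.
have [n [s [gs <-]]] := Fgen g; have [a [b [m [W [r red _ _]]]]] := represents_of_word gs.
by exists a, b, m.
Qed.

Lemma drop_exposed_last t : 1 < ncarets t -> exposed t (ncarets t).-1 ->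
  exists2 t', ncarets t' = (ncarets t).-1 & leaf_exponent t' = leaf_exponent t.
Proof.
move=> t1; have tp : (ncarets t).-1 < ncarets t by lia.
move/(exposed_subtree_at 0 tp); rewrite add0n => h.
have h' : subtree_at t 0 (0 + (ncarets t).-1) (0 + (ncarets t).+1).
  by rewrite !add0n; move: h; rewrite prednK //; lia.
have [t' n' e'] := drop_last_caret t1 h'.
by exists t' => //; apply: funext => i; rewrite -!sexpE.
Qed.

(** Realize the sequences of some reduced representation by two trees with the same
    number of carets, as few as possible.  A caret exposed at the same place in
    both trees would contradict reducedness, or minimality if it is the last one. *)
Lemma reduced_diagram_exists (g : F) :
  exists D, [/\ is_tree_pair D, is_reduced D & represented D = g].
Proof.
have [a [b [m [r red]]]] := represents_exists g.
pose T N := exists t1 t2, [/\ 0 < N, ncarets t1 = N, ncarets t2 = N,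
  leaf_exponent t1 = a & leaf_exponent t2 = b].
have ex : exists N, `[< T N >].
  have [B [aB bB] _] := r; pose N := (B + psum a B + psum b B).+1.
  have [|t1 n1 ea] := build_tree (N := N) aB; first by rewrite /N; lia.
  have [|t2 n2 eb] := build_tree (N := N) bB; first by rewrite /N; lia.
  by exists N; apply/asboolP; exists t1, t2.
case: (ex_minnP ex) => N /asboolP [t1 [t2 [N0 n1 n2 ea eb]]] Nmin.
have Dp : is_tree_pair (t1, t2) by rewrite /is_tree_pair /= n1 n2 N0 eqxx.
exists (t1, t2); split=> //; last first.
  by have := representedE Dp; rewrite /= ea eb => /(represents_fun r) [].
rewrite /is_reduced /size_pair /= n1; have [//|N1] := eqVneq N 1.
apply/hasPn => i; rewrite mem_iota add0n /= => iN; apply/negP => /andP [x1 x2].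
have [iN1|eiN] : i.+1 < N \/ i = N.-1 by lia.
  have [|a1 a2] := exponent_exposed _ x1; first by rewrite n1.
  have [|b1 b2] := exponent_exposed _ x2; first by rewrite n2.
  have := red i; rewrite -ea -eb; lia.
rewrite eiN -{1}n1 in x1; rewrite eiN -{1}n2 in x2.
have [|t1' n1' e1'] := drop_exposed_last _ x1; first lia.
have [|t2' n2' e2'] := drop_exposed_last _ x2; first lia.
have /asboolP/Nmin : T N.-1; last lia.
by exists t1', t2'; split; rewrite ?e1' ?e2' //; lia.
Qed.

Lemma reduced_diagramP (g : F) : let D := reduced_diagram g in
  [/\ is_tree_pair D, is_reduced D & represented D = g].
Proof. exact: xgetPex (reduced_diagram_exists g). Qed.

Theorem theorem3p3 (n : nat) (n_ge1 : 1 <= n) (g : F) :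
  word_length (X_ n) g = l_infty g + 2 * penalty_weight n g.
Proof.
have [Dp Dr eg] := reduced_diagramP g.
have r := representedE Dp; rewrite eg -/(l_infty g) in r.
have [[W sW gW] Wmin] := penalty_weightP n_ge1 Dp Dr.
have [s [gs es ss]] := word_of_sufficient n_ge1 r gW.
rewrite /word_length; set A := (X in natmin X).
have As : A (size s) by exists s.
have [[s' [es' gs' ps']] Amin] := natminP (ex_intro _ _ As).
apply/eqP; rewrite eqn_leq -/(penalty_weight n g) in sW *; apply/andP; split.
  by apply: leq_trans (Amin _ As) _; rewrite -sW.
have [a [b [m [W' [r' red' gW' le]]]]] := represents_of_word gs'.
rewrite ps' in r'.
have [ea eb] := represents_inj (is_reduced_exponents Dp Dr) red' r r'.
rewrite -ea -eb in r' gW'; have [_ em] := represents_fun r r'.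
have := Wmin _ gW'; rewrite -/(penalty_weight n g) -es' em => le'.
by apply: leq_trans le; rewrite leq_add2l leq_mul2l.
Qed.
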